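(* Let $\Pi$ and $\Pi'$ be two Poisson structures defined on neighborhoods of $\Gamma=S^1\times\{0\}$ in $S^1\times\mathbb{R}^n$, both in normal form (as defined in the context), with real parameters $(\mu_i)_{1\le i\le n},(a_{i,j})_{1\le i,j\le n}$ and $(\mu'_i)_{1\le i\le n},(a'_{i,j})_{1\le i,j\le n}$ respectively. Suppose that $\Pi$ and $\Pi'$ are equivalent along $\Gamma$, i.e. that there is a Poisson isomorphism $\Phi$ from a neighborhood of $\Gamma$ equipped with $\Pi$ onto a neighborhood of $\Gamma$ equipped with $\Pi'$, with $\Phi(\Gamma)=\Gamma$. Then, up to a re-indexation of the coordinates, $\Pi$ and $\Pi'$ have the same parameters: there is a permutation $\sigma$ of $\{1,\dots,n\}$ such that $\mu'_{\sigma(i)}=\mu_i$ and $a'_{\sigma(i),\sigma(j)}=a_{i,j}$ for all $i,j=1,\dots,n$. In other words, the parameters $\mu_i$ and $a_{i,j}$ appearing in the normal form are invariants of the Poisson structure.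
   Context: $S^1=\mathbb{R}/2\pi\mathbb{Z}$, with coordinates $(\theta,x_1,\dots,x_n)$ on $S^1\times\mathbb{R}^n$. A Poisson structure on a neighborhood of $\Gamma=S^1\times\{0\}$ is said here to be in normal form, with real parameters $\mu_i$ and $a_{i,j}$, if $$\{x_i,x_j\}=a_{i,j}\,x_ix_j+o_\infty(x),\qquad \{\theta,x_i\}=\mu_ix_i,\qquad i,j=1,\dots,n,$$ where $a_{i,j}=-a_{j,i}$ are constants, $o_\infty(x)$ denotes smooth functions flat along $\Gamma$ (vanishing with all their partial derivatives at every point of $\Gamma$; in the analytic category these terms are absent), and the real constants $\mu_1,\dots,\mu_n$ are non-resonant: there is no relation $\mu_i=p_1\mu_1+\dots+p_n\mu_n$ and no relation $\mu_i+\mu_j=p_1\mu_1+\dots+p_n\mu_n$ ($i\neq j$) with integers $p_k\ge0$, $\sum_kp_k\ge2$, other than the trivial relations $\mu_i+\mu_j=\mu_i+\mu_j$. (In particular the $\mu_i$ are distinct.) A Poisson isomorphism is a diffeomorphism intertwining the two Poisson structures.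
   Formalization: The equality μ'_{σ(i)}=μ_i is proved when Φ preserves the orientation of Γ; when Φ reverses it, μ'_{σ(i)}=−μ_i is proved instead, since (θ,x)↦(−θ,x) turns μ into −μ and refutes the original claim. The equality a'_{σ(i),σ(j)}=a_{i,j} is proved in both cases. *)

(* Defs.v *)
From HB Require Import structures.
From mathcomp Require Import all_boot all_order all_algebra all_fingroup.
From mathcomp Require Import generic_quotient.
From mathcomp Require Import all_classical all_reals all_analysis.

Set Implicit Arguments.
Unset Strict Implicit.
Unset Printing Implicit Defensive.

Import Order.TTheory GRing.Theory Num.Theory.
Import numFieldNormedType.Exports.

Local Open Scope ring_scope.
Local Open Scope classical_set_scope.
Local Open Scope quotient_scope.

Definition angle_eq (R : realType) (s t : R) : bool :=
  `[< exists k : int, t = s + k%:~R * (2 * pi) >].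

Lemma angle_eq_is_equiv (R : realType) : equiv_class_of (@angle_eq R).
Proof.
split=> [s|s t|t s u].
- by apply/asboolP; exists 0; rewrite mul0r addr0.
- apply/asboolP/asboolP => -[k ->]; exists (- k).
    by rewrite rmorphN mulNr addrK.
  by rewrite rmorphN mulNr addrK.
- move=> /asboolP[k ->] /asboolP[l ->]; apply/asboolP; exists (k + l).
  by rewrite intrD (mulrDl k%:~R) addrA.
Qed.

Canonical angle_eq_equiv (R : realType) :=
  EquivRelPack (angle_eq_is_equiv R).

Definition circle (R : realType) := quotient_topology {eq_quot @angle_eq R}.

Definition angle (R : realType) (t : R) : circle R := \pi_(circle R) t.

Definition cyl (R : realType) (n : nat) : topologicalType :=
  (circle R * 'rV[R]_n)%type.

(* The universal cover of S^1 x R^n is R^(n+1), with coordinates indexed by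
   'I_n.+1: index 0 is theta, index [lift ord0 i] is x_i. *)
Definition xidx (n : nat) (i : 'I_n) : 'I_n.+1 := lift ord0 i.

Definition cover (R : realType) (n : nat) (z : 'rV[R]_n.+1) : cyl R n :=
  (angle (z 0 0), \row_i z 0 (xidx i)).

(* An arbitrary (non-continuous) section of [cover]. *)
Definition lift_pt (R : realType) (n : nat) (q : cyl R n) : 'rV[R]_n.+1 :=
  \row_b oapp (fun i => q.2 0 i) (repr q.1) (unlift ord0 b).

Definition Gamma (R : realType) (n : nat) : set (cyl R n) :=
  [set q | q.2 = 0].

Definition open_nbhd_Gamma (R : realType) (n : nat) (U : set (cyl R n)) :=
  open U /\ @Gamma R n `<=` U.

Fixpoint Ck (R : realType) (V : normedModType R) (k : nat) (W : set V)
    (f : V -> R) : Prop :=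
  match k with
  | 0 => forall z, W z -> {for z, continuous f}
  | k'.+1 => (forall z, W z -> differentiable f z) /\
             (forall v, Ck k' W (fun z => 'D_v f z))
  end.

(* To be used on open sets [W]. *)
Definition smooth (R : realType) (V : normedModType R) (W : set V)
    (f : V -> R) : Prop := forall k, Ck k W f.

Definition smooth_fun (R : realType) (n : nat) (U : set (cyl R n))
    (f : cyl R n -> R) : Prop :=
  smooth (@cover R n @^-1` U) (f \o @cover R n).

(* Smoothness of a map in local charts of S^1 x R^n: near every point the map
   lifts to a smooth map between open sets of the universal cover. *)
Definition smooth_map (R : realType) (n : nat) (U : set (cyl R n))
    (Phi : cyl R n -> cyl R n) : Prop :=
  forall z : 'rV[R]_n.+1, U (cover z) ->
  exists (W : set 'rV[R]_n.+1) (F : 'rV[R]_n.+1 -> 'rV[R]_n.+1),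
    [/\ open W, W z,
        forall w, W w -> cover (F w) = Phi (cover w)
      & forall b : 'I_n.+1, smooth W (fun w => F w 0 b)].

Definition diffeo (R : realType) (n : nat) (U U' : set (cyl R n))
    (Phi : cyl R n -> cyl R n) : Prop :=
  smooth_map U Phi /\
  exists Psi : cyl R n -> cyl R n,
    [/\ smooth_map U' Psi,
        forall q, U q -> U' (Phi q) /\ Psi (Phi q) = q
      & forall q, U' q -> U (Psi q) /\ Phi (Psi q) = q].

(* Partial derivative with respect to theta ([b = 0]) or x_i ([b = xidx i]),
   computed on the universal cover; by periodicity it does not depend on the
   lift of the point, see [partial_cover]. *)
Definition partial (R : realType) (n : nat) (b : 'I_n.+1)
    (f : cyl R n -> R) (q : cyl R n) : R :=
  'D_(delta_mx 0 b) (f \o @cover R n) (lift_pt q).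

Lemma lift_ptK (R : realType) (n : nat) (q : cyl R n) : cover (lift_pt q) = q.
Proof.
case: q => c x; congr pair.
  by rewrite /lift_pt mxE unlift_none /angle reprK.
by apply/rowP => i; rewrite !mxE liftK.
Qed.

Lemma partial_cover (R : realType) (n : nat) (b : 'I_n.+1)
    (f : cyl R n -> R) (z : 'rV[R]_n.+1) :
  partial b f (cover z) = 'D_(delta_mx 0 b) (f \o @cover R n) z.
Proof.
rewrite /partial; move: (lift_ptK (cover z)).
move: (lift_pt _) => z' /esym Ez.
have /eqmodP/asboolP[k Ek] : angle (z 0 0) = angle (z' 0 0).
  exact: (congr1 fst Ez).
have Ex i : z' 0 (xidx i) = z 0 (xidx i).
  by have /rowP/(_ i) := congr1 snd Ez; rewrite !mxE.
have Ec w : cover (w + z') = cover (w + z).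
  congr pair; last by apply/rowP => i; rewrite !mxE Ex.
  rewrite /angle; apply/eqmodP/asboolP; exists (- k).
  by rewrite !mxE Ek rmorphN mulNr addrA addrK.
rewrite /derive; set g := (X in lim (X @ _)); set g' := (X in _ = lim (X @ _)).
by have -> : g = g' by apply/funext => h; rewrite /g /g' /= Ec Ez.
Qed.

(* o_oo(x): smooth on [U], with all partial derivatives (of all orders,
   including the function itself) vanishing on Gamma. *)
Definition flat_along_Gamma (R : realType) (n : nat) (U : set (cyl R n))
    (r : cyl R n -> R) : Prop :=
  smooth_fun U r /\
  forall (s : seq 'I_n.+1) (q : cyl R n),
    Gamma q -> foldr (@partial R n) r s q = 0.

(* The bivector field Pi is given by its matrix in the global frame
   d/dtheta, d/dx_1, ..., d/dx_n; its entry (b, c) is Pi(dz_b, dz_c), i.e. the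
   bracket {z_b, z_c} of coordinates (theta is only defined modulo 2 pi, but
   dtheta is a global form, so {theta, x_i} makes sense). *)
Definition bracket (R : realType) (n : nat) (Pi : cyl R n -> 'M[R]_n.+1)
    (f g : cyl R n -> R) (q : cyl R n) : R :=
  \sum_(b < n.+1) \sum_(c < n.+1) Pi q b c * partial b f q * partial c g q.

Record poisson (R : realType) (n : nat) (U : set (cyl R n))
    (Pi : cyl R n -> 'M[R]_n.+1) : Prop := Poisson {
  poisson_smooth : forall b c, smooth_fun U (fun q => Pi q b c) ;
  poisson_anti : forall q, U q -> (Pi q)^T = - Pi q ;
  poisson_jacobi : forall f g h, smooth_fun U f -> smooth_fun U g ->
    smooth_fun U h -> forall q, U q ->
    bracket Pi f (bracket Pi g h) q + bracket Pi g (bracket Pi h f) q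
    + bracket Pi h (bracket Pi f g) q = 0 }.

Definition nonresonant (R : realType) (n : nat) (mu : 'I_n -> R) : Prop :=
  (forall (i : 'I_n) (p : 'I_n -> nat), (2 <= \sum_k p k)%N ->
     mu i <> \sum_k (p k)%:R * mu k) /\
  (forall (i j : 'I_n) (p : 'I_n -> nat), i != j -> (2 <= \sum_k p k)%N ->
     mu i + mu j = \sum_k (p k)%:R * mu k ->
     forall k, p k = ((k == i) + (k == j))%N).

Record normal_form (R : realType) (n : nat) (U : set (cyl R n))
    (Pi : cyl R n -> 'M[R]_n.+1) (mu : 'I_n -> R) (a : 'I_n -> 'I_n -> R) :
    Prop := NormalForm {
  nf_nbhd : open_nbhd_Gamma U ;
  nf_poisson : poisson U Pi ;
  nf_anti : forall i j, a i j = - a j i ;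
  nf_nonresonant : nonresonant mu ;
  nf_xx : forall i j, exists r : cyl R n -> R, flat_along_Gamma U r /\
    forall q, U q ->
      Pi q (xidx i) (xidx j) = a i j * q.2 0 i * q.2 0 j + r q ;
  nf_theta_x : forall i q, U q -> Pi q 0 (xidx i) = mu i * q.2 0 i }.

Definition poisson_iso (R : realType) (n : nat) (U U' : set (cyl R n))
    (Pi Pi' : cyl R n -> 'M[R]_n.+1) (Phi : cyl R n -> cyl R n) : Prop :=
  diffeo U U' Phi /\
  forall f g, smooth_fun U' f -> smooth_fun U' g -> forall q, U q ->
    bracket Pi (f \o Phi) (g \o Phi) q = bracket Pi' f g (Phi q).

(* [Phi] is an equivalence along Gamma: it restricts to a Poisson isomorphism
   between open neighborhoods [V] and [V'] of Gamma, contained in the domains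
   [U] and [U'] of the two structures, and maps Gamma onto Gamma. *)
Definition equivalence_along_Gamma (R : realType) (n : nat)
    (U U' : set (cyl R n)) (Pi Pi' : cyl R n -> 'M[R]_n.+1)
    (Phi : cyl R n -> cyl R n) : Prop :=
  exists V V' : set (cyl R n),
    [/\ open_nbhd_Gamma V /\ V `<=` U,
        open_nbhd_Gamma V' /\ V' `<=` U',
        poisson_iso V V' Pi Pi' Phi
      & Phi @` @Gamma R n = @Gamma R n].

(* [Phi], restricted to Gamma = S^1, preserves the orientation by theta: it
   has a continuous increasing lift R -> R.  This matters for the parameters of
   the normal form: (theta, x) |-> (- theta, x) reverses this orientation and
   turns the parameters (mu, a) into (- mu, a). *)
Definition preserves_orientation_Gamma (R : realType) (n : nat)
    (Phi : cyl R n -> cyl R n) : Prop :=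
  exists phi : R -> R, [/\ continuous phi, {homo phi : s t / s < t} &
    forall t, Phi (angle t, 0) = (angle (phi t), 0)].

(* Main.v *)
(** On the universal cover write [Phi = (f, g_1, ..., g_n)], so [g_k = 0] on
    [Gamma], and expand the bracket relations in powers of [x]. The first order
    part of [{f, g_k} = mu'_k g_k] is
    [(df/dtheta * mu_i - mu'_k) * dg_k/dx_i = 0]. The matrix [dg_k/dx_i] is
    invertible along [Gamma], so the continuous function [df/dtheta] takes
    finitely many values there: it is a constant [c], [Phi] acts on [Gamma] by
    [t |-> c t + p], and bijectivity forces [c = 1] or [c = -1]. Since the
    [mu_i] are distinct, [g_(sigma i) = b_i(theta) x_i + O(x^2)] for a
    permutation [sigma], with [b_i] nowhere zero and
    [mu'_(sigma i) = c mu_i]. The coefficient of [x_i x_j] in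
    [{g_(sigma i), g_(sigma j)}] then gives
    [mu_j b_i'/b_i - mu_i b_j'/b_j = a'_(sigma i, sigma j) - a_(i, j)], and the
    left side is the derivative of the periodic function
    [mu_j ln |b_i| - mu_i ln |b_j|], hence vanishes somewhere. *)

Require Import Defs.
From mathcomp Require Import all_boot all_order all_algebra all_fingroup.
From mathcomp Require Import generic_quotient.
From mathcomp Require Import all_classical all_reals all_analysis.
From mathcomp Require Import ring lra.
(* Again, because [cover] is also a name of MathComp and MathComp-Analysis. *)
Import Defs.

Set Implicit Arguments.
Unset Strict Implicit.
Unset Printing Implicit Defensive.

Import Order.TTheory GRing.Theory Num.Theory.
Import numFieldNormedType.Exports.

Local Open Scope ring_scope.
Local Open Scope classical_set_scope.

(** * Calculus of real-valued functions on a normed module *)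

Section NormedModule.
Context (R : realType) (V : normedModType R).
Implicit Types (f g h : V -> R) (W : set V).

(** Differentiability depends only on the germ: [g - f] has zero germ at [z], so adding it to [f] is
    harmless once such a function is known to be differentiable. *)
Lemma near_eq_differentiable f g z :
  (\near z, f z = g z) -> differentiable f z -> differentiable g z.
Proof.
move=> fg df; have {}fg : \near z, (g - f) z = 0.
  by apply: filterS fg => w /= fgw; rewrite /= !fctE fgw subrr.
rewrite -[g](subrK f); apply: differentiableD => //.
move: (g - f) fg => {f g df} h h0.
apply/diffP => /=.
(* The differential is defined by [get], so it has the required property as soon as some continuous
   linear map has it; the differential of the constant 0 does. *)
apply: (@getPex _ (fun df : {linear V -> R} => continuous df /\
  forall y, h y = h (lim (nbhs z)) + df (y - lim (nbhs z))
                  +o_(y \near z) (y - lim (nbhs z)))).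
exists ('d (cst (0 : R)) z); split; first exact/diff_continuous/differentiable_cst.
move=> w; rewrite lim_id // (nbhs_singleton h0) diff_cst.
suff /funeqP/(_ w) /= : h = (fun y => 0 + 0 (y - z)) +o_ z (center z) by [].
apply/eqaddoP => e e0; apply: filterS h0 => y /= h0.
by rewrite !fctE h0 addr0 subrr normr0 mulr_ge0 // ltW.
Qed.

Lemma is_derive_line f w u (s : R) : derivable f (w + s *: u) u ->
  is_derive s 1 (fun s : R => f (w + s *: u)) ('D_u f (w + s *: u)).
Proof.
move=> df.
have E : (fun h : R => h^-1 *: (f (w + (h *: 1 + s) *: u) - f (w + s *: u)))
       = (fun h : R => h^-1 *: (f (h *: u + (w + s *: u)) - f (w + s *: u))).
  apply/funext => h; congr (_ *: (f _ - _)).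
  by rewrite scalerDl [h *: 1]mulr1 addrCA.
split; first by rewrite /derivable E.
by rewrite /derive E.
Qed.

Lemma derive_translate f c w u : 'D_u (fun w => f (c + w)) w = 'D_u f (c + w).
Proof.
rewrite /derive; set F := (X in lim (X @ _)); set G := (X in _ = lim (X @ _)).
by have -> : F = G by apply/funext => s; rewrite /F /G /= addrCA.
Qed.

Lemma differentiable_translate f c w :
  differentiable f (c + w) -> differentiable (fun w => f (c + w)) w.
Proof.
move=> df; apply: (@differentiable_comp _ _ _ _ (fun w => c + w) f) => //.
Qed.

Lemma deriveZdir f w (s : R) u : differentiable f w ->
  'D_(s *: u) f w = s * 'D_u f w.
Proof. by move=> df; rewrite !deriveE // linearZ. Qed.

Lemma differentiable_comp1 (g : R -> R) h z :
  derivable g (h z) 1 -> differentiable h z -> differentiable (g \o h) z.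
Proof. by move=> /derivable1_diffP dg dh; exact: differentiable_comp. Qed.

Lemma derive_comp1 (g : R -> R) h z u :
  derivable g (h z) 1 -> differentiable h z ->
  'D_u (g \o h) z = g^`()%classic (h z) * 'D_u h z.
Proof.
move=> /derivable1_diffP dg dh.
rewrite deriveE; last exact: differentiable_comp.
by rewrite diff_comp //= diff1E // -deriveE // mulrC.
Qed.

Lemma MVT_line f w u :
  (forall s : R, 0 <= s <= 1 -> differentiable f (w + s *: u)) ->
  exists2 s : R, 0 <= s <= 1 & f (w + u) - f w = 'D_u f (w + s *: u).
Proof.
move=> df.
have Ds (s : R) : 0 <= s <= 1 ->
    is_derive s 1 (fun s : R => f (w + s *: u)) ('D_u f (w + s *: u)).
  by move=> s01; apply/is_derive_line/diff_derivable/df.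
have [||s s01] := @MVT_segment R (fun s : R => f (w + s *: u))
  (fun s => 'D_u f (w + s *: u)) 0 1 ler01.
- by move=> s; rewrite in_itv /= => /andP[/ltW s0 /ltW s1]; apply: Ds; rewrite s0.
- apply: derivable_within_continuous => s; rewrite in_itv /= => s01.
  by case: (Ds s s01).
by rewrite subr0 mulr1 scale1r scale0r addr0; exists s.
Qed.

Lemma derive_quotient_cvg f z u : differentiable f z ->
  (fun s : R => s^-1 * (f (z + s *: u) - f z)) @ 0^' --> 'D_u f z.
Proof.
move=> /(@diff_derivable _ _ _ _ _ u) /cvg_ex[l fl].
have -> : 'D_u f z = l by exact: cvg_lim.
apply: (cvg_trans _ fl); apply: near_eq_cvg; apply: nearW => s.
by rewrite /= [z + _]addrC.
Qed.

Lemma line_near (P : set V) z u : nbhs z P -> \forall s \near (0 : R)^', P (z + s *: u).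
Proof.
move=> zP; apply: cvg_within.
have c0 : z + s *: u @[s --> (0 : R)] --> z + (0 : R) *: u.
  by apply: cvgD; [exact: cvg_cst | exact: scalel_continuous].
by apply: c0; rewrite scale0r addr0.
Qed.

Lemma line_cvg f z u : {for z, continuous f} ->
  f (z + s *: u) @[s --> (0 : R)^'] --> f z.
Proof. by move=> cf A /cf /= fA; exact: (line_near u fA). Qed.

Lemma Ck_sub k W W' f : W' `<=` W -> Ck k W f -> Ck k W' f.
Proof.
elim: k f => [|k IH] f sW /=; first by move=> cf z /sW /cf.
by case=> df cf; split=> [z /sW /df //|v]; exact: IH.
Qed.

Lemma smooth_derive W f v : smooth W f -> smooth W ('D_v f).
Proof. by move=> sf k; have /= [_] := sf k.+1; exact. Qed.

Lemma smooth_differentiable W f z : smooth W f -> W z -> differentiable f z.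
Proof. by move=> sf Wz; have /= [+ _] := sf 1%N; exact. Qed.

Lemma smooth_continuous W f z : smooth W f -> W z -> {for z, continuous f}.
Proof. by move=> sf; exact: (sf 0). Qed.

Lemma Ck_cst k W (a : R) : Ck k W (fun=> a).
Proof.
elim: k a => [|k IH] a /=; first by move=> z _; exact: cst_continuous.
split=> [z _|v]; first exact: differentiable_cst.
suff -> : (fun z => 'D_v (fun=> a) z) = (fun=> 0) by exact: IH.
by apply/funext => z; rewrite (derive_cst (a : R)).
Qed.

(** Needed because maps into the cylinder are smooth only through local lifts, which change from
    point to point. *)
Lemma Ck_local k W f :
  (forall z, W z -> exists W' g,
     [/\ open W', W' z, forall w, W' w -> f w = g w & Ck k W' g]) -> Ck k W f.
Proof.
elim: k f => [|k IH] f /= Wf.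
  move=> z /Wf[W' [g [oW' W'z fg cg]]].
  have nfg : \near z, g z = f z.
    by apply: filterS (open_nbhs_nbhs (conj oW' W'z)) => w /fg.
  apply: (cvg_trans (near_eq_cvg nfg)).
  by rewrite -(nbhs_singleton nfg); exact: cg.
split=> [z /Wf[W' [g [oW' W'z fg [dg _]]]]|v].
  apply: near_eq_differentiable (dg z W'z).
  by apply: filterS (open_nbhs_nbhs (conj oW' W'z)) => w /fg.
apply: IH => z /Wf[W' [g [oW' W'z fg [_ cg]]]].
exists W', ('D_v g); split => // w W'w.
apply: near_eq_derive.
by apply: filterS (open_nbhs_nbhs (conj oW' W'w)) => w' /fg.
Qed.

Lemma smooth_local W f :
  (forall z, W z -> exists W' g,
     [/\ open W', W' z, forall w, W' w -> f w = g w & smooth W' g]) ->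
  smooth W f.
Proof.
move=> Wf k; apply: Ck_local => z /Wf[W' [g [? ? ? sg]]].
by exists W', g; split => //; exact: sg.
Qed.

(** The mixed second difference quotient [X s] is, by two mean value theorems, a value of
    ['D_u ('D_v f)] near [z]. It tends to a difference quotient of ['D_u f] as [s] tends to 0, and
    then to ['D_v ('D_u f) z] as [h] does. *)
Lemma schwarz W f z u v : open W -> W z -> smooth W f ->
  'D_v ('D_u f) z = 'D_u ('D_v f) z.
Proof.
move=> oW Wz sf.
pose g := 'D_u ('D_v f).
have cg : {for z, continuous g}.
  by apply: smooth_continuous Wz; do 2!apply: smooth_derive.
have df w : W w -> differentiable f w by exact: smooth_differentiable.
have dDf x w : W w -> differentiable ('D_x f) w.
  by move=> Ww; apply: smooth_differentiable Ww; exact: smooth_derive.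
apply: (cvg_unique _ (derive_quotient_cvg (dDf u z Wz) (u := v))) => //.
have -> : 'D_u ('D_v f) z = g z by [].
apply/cvgrPdist_le => e e0.
have e20 : 0 < e / 2 by rewrite divr_gt0.
have /nbhs_ballP[d /= d0 Bd] : \forall w \near z, W w /\ `|g z - g w| <= e / 2.
  apply: filterI; first exact: open_nbhs_nbhs.
  by move/cvgrPdist_le : cg; apply.
have Wg (h s : R) : `|h| * `|v| < d / 2 -> `|s| * `|u| < d / 2 ->
    W (z + (h *: v + s *: u)) /\ `|g z - g (z + (h *: v + s *: u))| <= e / 2.
  move=> hd sd; apply: Bd; rewrite -ball_normE /ball_ /= opprD addNKr normrN.
  by rewrite (le_lt_trans (ler_normD _ _)) // !normrZ (splitr d) ltrD.
have near0 (x : V) : \forall s \near (0 : R)^', s != 0 /\ `|s| * `|x| < d / 2.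
  have [->|x0] := eqVneq x 0.
    near=> s; rewrite normr0 mulr0 divr_gt0 //; split=> //.
    by near: s; exact: nbhs_dnbhs_neq.
  have dx : 0 < d / 2 / `|x| by rewrite !divr_gt0 ?normr_gt0.
  near=> s; split; first by near: s; exact: nbhs_dnbhs_neq.
  by rewrite -ltr_pdivlMr ?normr_gt0 //; near: s; exact: dnbhs0_lt.
near=> h.
have [h0 hd] : h != 0 /\ `|h| * `|v| < d / 2 by near: h; exact: near0.
have Wzh : W (z + h *: v).
  have := Wg h 0; rewrite scale0r addr0 normr0 mul0r divr_gt0 //.
  by move=> H; have [] := H hd isT.
pose X s := h^-1 * (s^-1 * (f (z + h *: v + s *: u) - f (z + h *: v))
                   - s^-1 * (f (z + s *: u) - f z)).
have cX : X s @[s --> 0^'] --> h^-1 * ('D_u f (z + h *: v) - 'D_u f z).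
  by apply: cvgMl_tmp; apply: cvgB; exact/derive_quotient_cvg/df.
(* [s] is chosen after [h]. Half of [e] pays for replacing the limit in [s] by [X s], the other half
   for the variation of [g] near [z]. *)
near (0 : R)^' => s.
have [s0 sd] : s != 0 /\ `|s| * `|u| < d / 2 by near: s; exact: near0.
rewrite (splitr e) -(subrKA (X s)) (le_trans (ler_normD _ _)) // lerD //; last first.
  by near: s; apply: cvgr_distC_le.
have small (k x y : R) : 0 <= k <= 1 -> `|x| * y < d / 2 -> 0 <= y ->
    `|k * x| * y < d / 2.
  move=> /andP[k0 k1] xy y0; apply: le_lt_trans xy.
  by rewrite normrM ger0_norm // -mulrA ler_piMl // mulr_ge0.
have Wk (k l : R) : 0 <= k <= 1 -> 0 <= l <= 1 ->
    let w := z + k *: (h *: v) + l *: (s *: u) in W w /\ `|g z - g w| <= e / 2.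
  move=> k01 l01 /=; rewrite !scalerA -addrA.
  by apply: Wg; exact: small.
have Wk0 (k : R) : 0 <= k <= 1 -> W (z + k *: (h *: v)).
  by move=> k01; have [] := Wk k 0 k01 _; rewrite ?lexx ?ler01 // scale0r addr0.
have Wk1 (k : R) : 0 <= k <= 1 -> W (s *: u + (z + k *: (h *: v))).
  move=> k01; have [] := Wk k 1 k01 _; rewrite ?lexx ?ler01 //.
  by rewrite scale1r [X in W X]addrC.
(* The first mean value theorem is along [v], for the increment [f1] of [f] in direction [u]; the
   second is along [u], for ['D_v f]. *)
pose f1 w := f (s *: u + w) - f w.
have df1 (k : R) : 0 <= k <= 1 -> differentiable f1 (z + k *: (h *: v)).
  move=> k01; apply: differentiableB; last exact/df/Wk0.
  exact/differentiable_translate/df/Wk1.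
have [k k01 fk] := MVT_line df1.
have [r r01 fr] := @MVT_line ('D_v f) (z + k *: (h *: v)) (s *: u)
  (fun r r01 => dDf v _ (Wk k r k01 r01).1).
suff -> : X s = g (z + k *: (h *: v) + r *: (s *: u)) by exact: (Wk _ _ _ _).2.
have -> : X s = h^-1 * (s^-1 * (f1 (z + h *: v) - f1 z)).
  by rewrite /X /f1 ![s *: u + _]addrC; ring.
rewrite fk deriveZdir; last exact: df1.
rewrite /f1 deriveB; first last.
- exact/diff_derivable/df/Wk0.
- exact/diff_derivable/differentiable_translate/df/Wk1.
rewrite derive_translate [s *: u + _]addrC fr deriveZdir; last exact/dDf/(Wk _ _ _ _).1.
by rewrite [s^-1 * _]mulrCA !mulKf.
Unshelve. all: by end_near. Qed.

End NormedModule.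

(** * Coordinates and the chain rule on row vectors *)

Section RowVector.
Context (R : realType) (m : nat).
Implicit Types (f : 'rV[R]_m.+1 -> R) (z u : 'rV[R]_m.+1).

Lemma derive_row f z u : differentiable f z ->
  'D_u f z = \sum_b u 0 b * 'D_(delta_mx 0 b) f z.
Proof.
move=> df; rewrite deriveE // {1}(row_sum_delta u) linear_sum.
by apply: eq_bigr => b _; rewrite linearZ deriveE.
Qed.

Lemma derive_coord b z v : 'D_v (fun z : 'rV[R]_m.+1 => z 0 b) z = v 0 b.
Proof.
have := derive_mx (@derivable_id R _ z v).
by rewrite derive_id => /matrixP/(_ 0 b); rewrite mxE.
Qed.

Lemma coord_smooth W (b : 'I_m.+1) : smooth W (fun z : 'rV[R]_m.+1 => z 0 b).
Proof.
case=> [|k] /=; first by move=> z _; exact: coord_continuous.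
split=> [z _|v]; first exact: differentiable_coord.
suff -> : (fun z => 'D_v (fun z : 'rV[R]_m.+1 => z 0 b) z) = (fun=> v 0 b).
  exact: Ck_cst.
by apply/funext => z; rewrite derive_coord.
Qed.

Lemma continuous_row (F : 'rV[R]_m.+1 -> 'rV[R]_m.+1) z :
  (forall b, {for z, continuous (fun w => F w 0 b)}) -> {for z, continuous F}.
Proof.
move=> cF; apply: (cvg_ballP (F := nbhs z) F (F z)).2 => e e0.
have : \forall w \near z, forall b, ball (F z 0 b) e (F w 0 b).
  refine (@filter_forall _ _ (fun b w => ball (F z 0 b) e (F w 0 b))
    (nbhs z) _ (fun b => _)).
  by have /(cvg_ballP (F := nbhs z)) := cF b; apply.
by apply: filterS => w Fw; split=> // i b; rewrite (ord1 i).
Qed.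

Lemma derive_comp_row f (F : 'rV[R]_m.+1 -> 'rV[R]_m.+1) z u :
  (forall b, differentiable (fun w => F w 0 b) z) -> differentiable f (F z) ->
  'D_u (f \o F) z =
  \sum_b 'D_u (fun w => F w 0 b) z * 'D_(delta_mx 0 b) f (F z).
Proof.
move=> dF df.
have dF' : differentiable F z.
  have -> : F = \sum_b (fun w => F w 0 b *: delta_mx 0 b).
    by apply/funext => w; rewrite fct_sumE {1}(row_sum_delta (F w)).
  by apply: differentiable_sum => b; exact: differentiableZl.
rewrite deriveE; last exact: differentiable_comp.
rewrite diff_comp //= -deriveE // -deriveE // derive_row //.
apply: eq_bigr => b _; congr (_ * _).
by rewrite (derive_mx (diff_derivable dF')) mxE.
Qed.

End RowVector.

(** * Growth of functions away from the axis *)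

Section Transverse.
Context (R : realType) (n : nat).
Implicit Types (f : 'rV[R]_n.+1 -> R) (z w u : 'rV[R]_n.+1).

Definition xnorm w : R := \sum_(i < n) `|w 0 (xidx i)|.

(** The axis is the preimage of [Gamma] in the universal cover. *)
Definition on_axis w := forall i : 'I_n, w 0 (xidx i) = 0.

Definition axis (t : R) : 'rV[R]_n.+1 := t *: delta_mx 0 0.

Lemma axis0 t : axis t 0 0 = t.
Proof. by rewrite !mxE !eqxx mulr1. Qed.

Lemma axisx t : on_axis (axis t).
Proof. by move=> i; rewrite !mxE mulr0. Qed.

Lemma axisE t : axis t = 0 + t *: delta_mx 0 0.
Proof. by rewrite add0r. Qed.

Lemma derive_transverse f z u : differentiable f z -> u 0 0 = 0 ->
  'D_u f z = \sum_i u 0 (xidx i) * 'D_(delta_mx 0 (xidx i)) f z.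
Proof. by move=> df u0; rewrite derive_row // big_ord_recl u0 mul0r add0r. Qed.

(** The mean value theorem on the segment from the projection of [w] on the axis to [w]: only
    transverse derivatives enter, and [xnorm] does not exceed [xnorm w] on that segment. *)
Lemma vanishing_bound f z (d M : R) p : on_axis z -> 0 <= M ->
  (forall w, ball z d w -> differentiable f w) ->
  (forall w, ball z d w -> on_axis w -> f w = 0) ->
  (forall i w, ball z d w ->
    `|'D_(delta_mx 0 (xidx i)) f w| <= M * xnorm w ^+ p) ->
  forall w, ball z d w -> `|f w| <= M * xnorm w ^+ p.+1.
Proof.
move=> z0 M0 df f0 Df w Bw.
pose w0 := axis (w 0 0); pose u := w - w0.
have uE b : u 0 b = w 0 b - w0 0 b by rewrite [LHS]mxE; congr (_ + _); rewrite mxE.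
have u0 : u 0 0 = 0 by rewrite uE axis0 subrr.
have ux i : u 0 (xidx i) = w 0 (xidx i).
  by rewrite uE axisx subr0.
have wsE (s : R) b : (w0 + s *: u) 0 b = w0 0 b + s * u 0 b.
  by rewrite [LHS]mxE; congr (_ + _); rewrite mxE.
(* Balls are products of intervals and [z] is on the axis, so shrinking the transverse coordinates
   of [w] does not leave the ball. *)
have Bs (s : R) : 0 <= s <= 1 -> ball z d (w0 + s *: u).
  move=> /andP[s0 s1]; case: Bw => d0 Bw; split => // i b; rewrite (ord1 i).
  move: (Bw 0 b); rewrite /ball /= /ball_ /=; case: (unliftP 0 b) => [k|] ->.
    rewrite (z0 k) !sub0r !normrN wsE axisx add0r ux normrM ger0_norm //.
    by apply: le_lt_trans; rewrite ler_piMl.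
  by rewrite wsE u0 mulr0 addr0 axis0.
have [s s01|s /andP[s0 s1]] := @MVT_line R _ f w0 u; first exact/df/Bs.
rewrite {1}/u subrKC (f0 w0) ?subr0; first last.
- exact: axisx.
- by have := Bs 0; rewrite scale0r addr0; apply; rewrite lexx ler01.
have Bws := Bs s; rewrite s0 s1 in Bws; have {}Bws := Bws isT.
move=> ->; rewrite derive_transverse //; last exact: df.
have xs : xnorm (w0 + s *: u) <= xnorm w.
  apply: ler_sum => i _; rewrite wsE axisx add0r ux normrM ger0_norm //.
  by rewrite ler_piMl.
have x0 v : 0 <= xnorm v by exact: sumr_ge0.
apply: (le_trans (ler_norm_sum _ _ _)).
rewrite exprSr mulrA {2}/xnorm mulr_sumr.
apply: ler_sum => i _; rewrite normrM ux mulrC ler_wpM2r //.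
apply: (le_trans (Df i _ Bws)); rewrite ler_wpM2l //.
by rewrite lerXn2r ?nnegrE.
Qed.

End Transverse.

(** * The circle, and cosine and sine on it *)

Section Circle.
Context (R : realType).
Implicit Types (s t : R).

Lemma angleP s t :
  reflect (exists k : int, t = s + k%:~R * (2 * pi)) (angle s == angle t).
Proof.
apply: (iffP eqP) => [/eqmodP/asboolP //|st].
by apply/eqmodP/asboolP.
Qed.

Lemma cos_intr2pi t (k : int) : cos (t + k%:~R * (2 * pi)) = cos t.
Proof.
have P x j : cos (x + j%:R * (2 * pi)) = cos x :> R.
  elim: j => [|j IH]; first by rewrite mul0r addr0.
  by rewrite -addn1 natrD mulrDl mul1r addrA mulr_natl [2 * pi]mulr_natl
    cosD2pi -[X in x + X]mulr_natl -[pi *+ 2]mulr_natl.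
case: k => j; first exact: P.
by rewrite NegzE rmorphN /= mulNr -[in RHS](subrK (j.+1%:R * (2 * pi)) t) P.
Qed.

Lemma sin_intr2pi t (k : int) : sin (t + k%:~R * (2 * pi)) = sin t.
Proof.
by rewrite -2!cosBpihalf addrAC cos_intr2pi.
Qed.

Lemma cos_eq1 t : cos t = 1 -> exists k : int, t = k%:~R * (2 * pi).
Proof.
move=> ct; pose k := Num.floor (t / (2 * pi)); exists k.
have pi2 : 0 < 2 * pi :> R by rewrite mulr_gt0 ?pi_gt0.
pose r := t - k%:~R * (2 * pi).
have cr : cos r = 1 by rewrite /r -mulNr -rmorphN cos_intr2pi.
have r0 : 0 <= r by rewrite subr_ge0 -ler_pdivlMr //; exact: ge_floor.
have r2 : r < 2 * pi.
  rewrite ltrBlDr -[X in _ < X + _]mul1r -mulrDl -ltr_pdivrMr // addrC.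
  by have := lt_succ_floor (t / (2 * pi)); rewrite intrD.
suff /eqP : r = 0 by rewrite subr_eq0 => /eqP.
have cos1 (x : R) : 0 <= x <= pi -> cos x = 1 -> x = 0.
  move=> x0 cx; have := @cos_inj R x 0; rewrite !in_itv /= lexx pi_ge0 x0 cx cos0.
  exact.
have [rpi|rpi] := leP r pi; first by apply: cos1; rewrite // r0.
(* In the second half of the period the reflected angle [2 * pi - r] lies in [[0, pi]] and also has
   cosine 1; its vanishing would contradict [r < 2 * pi]. *)
have : 2 * pi - r = 0; last by lra.
apply: cos1; first by apply/andP; split; lra.
rewrite -cosN opprB -[RHS]cr -[RHS](cos_intr2pi _ (- 1)).
by rewrite rmorphN mulN1r.
Qed.

(** The angle is not a global function on the circle, but its cosine and sine are, and a Poisson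
    isomorphism can be tested on them. *)
Definition cosq (c : circle R) : R := cos (repr c).
Definition sinq (c : circle R) : R := sin (repr c).

Lemma repr_angle t : exists k : int, repr (angle t) = t + k%:~R * (2 * pi).
Proof. by apply/angleP; rewrite /angle reprK. Qed.

Lemma cosq_angle t : cosq (angle t) = cos t.
Proof. by rewrite /cosq; have [k ->] := repr_angle t; rewrite cos_intr2pi. Qed.

Lemma sinq_angle t : sinq (angle t) = sin t.
Proof. by rewrite /sinq; have [k ->] := repr_angle t; rewrite sin_intr2pi. Qed.

(** The cosine of the difference of the two angles is a sum of squares equal to 1, so [cos_eq1]
    applies. *)
Lemma angle_eq_cossin (c : circle R) t : cosq c = cos t -> sinq c = sin t -> c = angle t.
Proof.
rewrite /cosq /sinq => cc ss; rewrite -[c]reprK; apply/eqP/angleP.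
have [k E] : exists k : int, repr c - t = k%:~R * (2 * pi).
  by apply: cos_eq1; rewrite cosB cc ss -!expr2 cos2Dsin2.
by exists (- k); rewrite rmorphN mulNr -E opprB subrKC.
Qed.

Lemma angle_continuous : continuous (@angle R).
Proof. exact: pi_continuous. Qed.

End Circle.

(** * Functions on the cylinder seen on the universal cover *)

Section Cover.
Context (R : realType) (n : nat).
Implicit Types (z w u : 'rV[R]_n.+1) (q : cyl R n) (U V : set (cyl R n)).

Lemma cover_continuous : continuous (@cover R n).
Proof.
move=> z; rewrite /cover; refine (@cvg_pair _ _ _
  (nbhs z) (nbhs (angle (z 0 0))) (nbhs (\row_i z 0 (xidx i))) _ _ _
  (fun z => angle (z 0 0))
  (fun z : 'rV[R]_n.+1 => \row_i z 0 (xidx i)) _ _).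
  apply: (@continuous_comp _ _ _ (fun z : 'rV[R]_n.+1 => z 0 0) (@angle R)).
    exact: coord_continuous.
  exact: angle_continuous.
apply/cvg_ballP => e e0; near=> w.
have [_ zw] : ball z e w by near: w; exact: nbhsx_ballx.
by split => // i j; rewrite !mxE; exact: zw.
Unshelve. all: by end_near. Qed.

Lemma open_cover U : open U -> open (@cover R n @^-1` U).
Proof. by move=> oU; apply: open_comp => // z _; exact: cover_continuous. Qed.

Lemma cover_axis z : on_axis z -> cover z = (angle (z 0 0), 0).
Proof. by move=> z0; congr pair; apply/rowP => i; rewrite !mxE z0. Qed.

Lemma Gamma_cover z : @Gamma R n (cover z) <-> on_axis z.
Proof.
split=> [/rowP z0 i|/cover_axis -> //].
by have := z0 i; rewrite !mxE.
Qed.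

Lemma partial_coverE b (f : cyl R n -> R) :
  partial b f \o @cover R n = 'D_(delta_mx 0 b) (f \o @cover R n).
Proof. by apply/funext => z; exact: partial_cover. Qed.

Definition xcoord (i : 'I_n) q : R := q.2 0 i.

Lemma xcoord_cover i z : xcoord i (cover z) = z 0 (xidx i).
Proof. by rewrite /xcoord mxE. Qed.

Lemma xcoord_smooth U i : smooth_fun U (xcoord i).
Proof.
rewrite /smooth_fun (_ : _ \o _ = (fun z => z 0 (xidx i))); first exact: coord_smooth.
by apply/funext => z; exact: xcoord_cover.
Qed.

Lemma partial_xcoord b i z : partial b (xcoord i) (cover z) = (b == xidx i)%:R.
Proof.
rewrite partial_cover (_ : _ \o _ = (fun z => z 0 (xidx i))).
  by rewrite derive_coord mxE eqxx eq_sym.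
by apply/funext => w; exact: xcoord_cover.
Qed.

(** This span is stable under the derivative in theta, which sends [(al, be)] to [(be, - al)];
    smoothness follows by induction on the order with both coefficients general. *)
Definition trigf (al be : R) q : R := al * cosq q.1 + be * sinq q.1.

Lemma trigf_cover al be z : trigf al be (cover z) = al * cos (z 0 0) + be * sin (z 0 0).
Proof. by rewrite /trigf /= cosq_angle sinq_angle. Qed.

Lemma derive_trig_coord al be z u :
  differentiable (fun z : 'rV[R]_n.+1 => al * cos (z 0 0) + be * sin (z 0 0) : R) z /\
  'D_u (fun z : 'rV[R]_n.+1 => al * cos (z 0 0) + be * sin (z 0 0)) z =
  u 0 0 * (be * cos (z 0 0) + (- al) * sin (z 0 0)).
Proof.
have dz : differentiable (fun z : 'rV[R]_n.+1 => z 0 0 : R) z.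
  exact: differentiable_coord.
have dc := differentiable_comp1 (@derivable_cos R _) dz.
have ds := differentiable_comp1 (@derivable_sin R _) dz.
split.
  by apply: differentiableD; apply: differentiableM => //; exact: differentiable_cst.
rewrite deriveD; [|exact/diff_derivable/differentiableZ..].
rewrite !deriveZ; [|exact: diff_derivable..].
rewrite (derive_comp1 _ (@derivable_cos R _) dz) (derive_comp1 _ (@derivable_sin R _) dz).
rewrite !derive1E !derive_val derive_coord /GRing.scale /=; ring.
Qed.

Lemma trigf_smooth U al be : smooth_fun U (trigf al be).
Proof.
rewrite /smooth_fun
  (_ : _ \o _ = (fun z => al * cos (z 0 0) + be * sin (z 0 0))); last first.
  by apply/funext => z; exact: trigf_cover.
move=> k; elim: k al be => [|k IH] al be /=.
  by move=> z _; have [+ _] := derive_trig_coord al be z 0;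
     exact: differentiable_continuous.
split=> [z _|v]; first by have [] := derive_trig_coord al be z 0.
rewrite (_ : (fun z => _) =
  (fun z => (v 0 0 * be) * cos (z 0 0) + (v 0 0 * - al) * sin (z 0 0))).
  exact: IH.
by apply/funext => z; have [_ ->] := derive_trig_coord al be z v; rewrite mulrDr !mulrA.
Qed.

Lemma partial_trigf b al be z :
  partial b (trigf al be) (cover z) = (b == 0)%:R * trigf be (- al) (cover z).
Proof.
rewrite partial_cover (_ : _ \o _ = (fun z => al * cos (z 0 0) + be * sin (z 0 0))).
  have [_ ->] := derive_trig_coord al be z (delta_mx 0 b).
  by rewrite mxE eqxx eq_sym trigf_cover.
by apply/funext => w; exact: trigf_cover.
Qed.

(** The second transverse derivatives vanish on the axis, hence are at most [e] near [z] by
    continuity. Two uses of [vanishing_bound] integrate this bound up to the function itself. *)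
Lemma flat_bound U r z e : open U -> U (cover z) -> flat_along_Gamma U r ->
  on_axis z -> 0 < e -> \forall w \near z, `|r (cover w)| <= e * xnorm w ^+ 2.
Proof.
move=> oU Uz [sr flat] z0 e0.
pose f := r \o @cover R n.
pose W := @cover R n @^-1` U.
have oW : open W by exact: open_cover.
pose D (i : 'I_n) := 'D_(delta_mx 0 (xidx i)) f.
pose DD (i j : 'I_n) := 'D_(delta_mx 0 (xidx i)) (D j).
have sD i : smooth W (D i) by exact: smooth_derive.
have sDD i j : smooth W (DD i j) by exact: smooth_derive.
have f0 w : on_axis w -> f w = 0 by move=> /Gamma_cover; exact: (flat [::]).
have D0 i w : on_axis w -> D i w = 0.
  by move=> /Gamma_cover /(flat [:: xidx i] (cover w)) /=; rewrite partial_cover.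
have DD0 i j w : on_axis w -> DD i j w = 0.
  move=> /Gamma_cover /(flat [:: xidx i; xidx j] (cover w)) /=.
  by rewrite partial_cover partial_coverE.
have : \forall w \near z, W w /\ forall i j, `|DD i j w| <= e.
  apply: filterI; first exact: open_nbhs_nbhs.
  refine (@filter_forall _ _ (fun i w => forall j, `|DD i j w| <= e)
    (nbhs z) _ (fun i => _)).
  refine (@filter_forall _ _ (fun j w => `|DD i j w| <= e) (nbhs z) _ (fun j => _)).
  have /cvgrPdist_le/(_ e e0) := smooth_continuous (sDD i j) (Uz : W z).
  by rewrite DD0 //; apply: filterS => w; rewrite sub0r normrN.
move=> /nbhs_ballP[d /= d0 Bd]; apply/nbhs_ballP; exists d => //= w.
apply: (@vanishing_bound _ _ f z d e 1) => //; first exact: ltW.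
- by move=> v /Bd[Wv _]; exact: smooth_differentiable Wv.
- by move=> v _; exact: f0.
move=> i; apply: (@vanishing_bound _ _ (D i) z d e 0) => //; first exact: ltW.
- by move=> v /Bd[Wv _]; exact: smooth_differentiable Wv.
- by move=> v _; exact: D0.
by move=> j v /Bd[_ DDv]; rewrite expr0 mulr1; exact: DDv.
Qed.

End Cover.

Lemma cvg_sumr (R : realType) (T I : Type) (F : set_system T) (FF : Filter F)
    (r : seq I) (f : I -> T -> R) (l : I -> R) :
  (forall i, f i x @[x --> F] --> l i) ->
  \sum_(i <- r) f i x @[x --> F] --> \sum_(i <- r) l i.
Proof. by move=> fl; apply: cvg_big => //; exact: add_continuous. Qed.

(** * First and second order expansion of a bracket in normal form *)

Section NormalForm.
Context (R : realType) (n : nat) (U : set (cyl R n)) (Pi : cyl R n -> 'M[R]_n.+1)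
  (mu : 'I_n -> R) (a : 'I_n -> 'I_n -> R).
Context (nf : normal_form U Pi mu a).
Implicit Types (z w u : 'rV[R]_n.+1) (A B : 'I_n.+1 -> 'rV[R]_n.+1 -> R).

Let oU : open U. Proof. by case: (nf_nbhd nf). Qed.

Let UGamma z : on_axis z -> U (cover z).
Proof. by move=> /Gamma_cover; case: (nf_nbhd nf) => _; apply. Qed.

Let nearU z : on_axis z -> \forall w \near z, U (cover w).
Proof.
by move=> z0; apply: open_nbhs_nbhs; split; [exact: open_cover | exact: UGamma].
Qed.

Lemma Pi_antisym q b c : U q -> Pi q b c = - Pi q c b.
Proof.
by move=> Uq; have /matrixP/(_ c b) := poisson_anti (nf_poisson nf) Uq; rewrite !mxE.
Qed.

Lemma Pi_00 q : U q -> Pi q 0 0 = 0.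
Proof. by move=> Uq; apply/eqP; rewrite -eqNr eq_sym; apply/eqP; exact: Pi_antisym. Qed.

Lemma nf_bracket_sum q (A B : 'I_n.+1 -> R) : U q ->
  \sum_b \sum_c Pi q b c * A b * B c =
  \sum_i mu i * q.2 0 i * (A 0 * B (xidx i) - A (xidx i) * B 0) +
  \sum_i \sum_j Pi q (xidx i) (xidx j) * A (xidx i) * B (xidx j).
Proof.
move=> Uq; rewrite big_ord_recl big_ord_recl Pi_00 // !mul0r add0r.
have -> : \sum_(i < n) \sum_c Pi q (lift ord0 i) c * A (lift ord0 i) * B c =
    \sum_i Pi q (xidx i) 0 * A (xidx i) * B 0 +
    \sum_i \sum_j Pi q (xidx i) (xidx j) * A (xidx i) * B (xidx j).
  by rewrite -big_split /=; apply: eq_bigr => i _; rewrite big_ord_recl.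
rewrite addrA -big_split /=; congr (_ + _); apply: eq_bigr => i _.
by rewrite [Pi q (xidx i) 0]Pi_antisym // (nf_theta_x nf) //; ring.
Qed.

Lemma nf_xx_bound z i j e : on_axis z -> 0 < e -> \forall w \near z,
  `|Pi (cover w) (xidx i) (xidx j) - a i j * w 0 (xidx i) * w 0 (xidx j)|
    <= e * xnorm w ^+ 2.
Proof.
move=> z0 e0; have [r [flatr Er]] := nf_xx nf i j.
near=> w; rewrite Er; last by near: w; exact: nearU.
rewrite !mxE addrC addKr; near: w; apply: flat_bound flatr _ _ => //.
exact: UGamma.
Unshelve. all: by end_near. Qed.

Lemma xnorm_line z (s : R) u : on_axis z -> xnorm (z + s *: u) = `|s| * xnorm u.
Proof.
move=> z0; rewrite /xnorm mulr_sumr; apply: eq_bigr => i _.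
by rewrite !mxE z0 add0r normrM.
Qed.

Lemma nf_xx_cvg z u i j : on_axis z ->
  s ^- 2 * Pi (cover (z + s *: u)) (xidx i) (xidx j) @[s --> (0 : R)^'] -->
  a i j * u 0 (xidx i) * u 0 (xidx j).
Proof.
move=> z0; apply/cvgrPdistC_le => e e0.
have x0 v : 0 <= xnorm v :> R by exact: sumr_ge0.
have N0 : 0 < 1 + xnorm u ^+ 2 by rewrite ltr_pwDl // sqr_ge0.
(* The summand 1 keeps the denominator positive when [u] has no transverse part. *)
pose e' := e / (1 + xnorm u ^+ 2); have e'0 : 0 < e' by exact: divr_gt0.
have Hb := line_near u (nf_xx_bound i j z0 e'0).
near=> s.
have s0 : s != 0 by near: s; exact: nbhs_dnbhs_neq.
have : `|Pi (cover (z + s *: u)) (xidx i) (xidx j) -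
    a i j * (z + s *: u) 0 (xidx i) * (z + s *: u) 0 (xidx j)| <=
         e' * (s ^+ 2 * xnorm u ^+ 2).
  rewrite -[s ^+ 2]ger0_norm ?sqr_ge0 // normrX -exprMn -(xnorm_line _ u z0).
  by near: s.
have wE k : (z + s *: u) 0 (xidx k) = s * u 0 (xidx k) by rewrite !mxE z0 add0r.
rewrite !wE => H.
rewrite [X in `|X|](_ : _ = s ^- 2 * (Pi (cover (z + s *: u)) (xidx i) (xidx j) -
    a i j * (s * u 0 (xidx i)) * (s * u 0 (xidx j)))); last by field.
have s20 : 0 < s ^+ 2 by rewrite exprn_even_gt0.
rewrite normrM ger0_norm ?invr_ge0 ?sqr_ge0 // ler_pdivrMl //.
apply: (le_trans H); rewrite mulrCA ler_wpM2l ?sqr_ge0 //.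
by rewrite /e' -mulrA ler_piMr ?(ltW e0) // [X in X <= 1]mulrC ler_pdivrMr // mul1r lerDr.
Unshelve. all: by end_near. Qed.

Let lineE z u (s : R) i : on_axis z ->
  (cover (z + s *: u)).2 0 i = s * u 0 (xidx i).
Proof. by move=> z0; rewrite !mxE z0 add0r. Qed.

(** [A] and [B] are the components of two covector fields. On the line, [{theta, x_i}] is linear in
    [s] while [{x_i, x_j}] is of order two, so only the former survives division by [s]. *)
Lemma nf_bracket_cvg1 z u A B : on_axis z ->
  (forall b, {for z, continuous (A b)}) -> (forall b, {for z, continuous (B b)}) ->
  s^-1 * (\sum_b \sum_c Pi (cover (z + s *: u)) b c *
            A b (z + s *: u) * B c (z + s *: u)) @[s --> (0 : R)^'] -->
  \sum_i mu i * u 0 (xidx i) * (A 0 z * B (xidx i) z - A (xidx i) z * B 0 z).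
Proof.
move=> z0 cA cB; set l := (X in _ --> X).
pose L s := \sum_i mu i * u 0 (xidx i) *
   (A 0 (z + s *: u) * B (xidx i) (z + s *: u) -
    A (xidx i) (z + s *: u) * B 0 (z + s *: u)) +
  \sum_i \sum_j s * (s ^- 2 * Pi (cover (z + s *: u)) (xidx i) (xidx j)) *
     A (xidx i) (z + s *: u) * B (xidx j) (z + s *: u).
have Us := line_near u (nearU z0).
apply: (@cvg_trans _ (L @ (0 : R)^')).
  apply: near_eq_cvg; near=> s.
  have s0 : s != 0 by near: s; exact: nbhs_dnbhs_neq.
  rewrite /L nf_bracket_sum; last by near: s.
  rewrite mulrDr !mulr_sumr; congr (_ + _); apply: eq_bigr => i _.
    by rewrite lineE //; field.
  by rewrite mulr_sumr; apply: eq_bigr => j _; field.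
(* The terms in [{x_i, x_j}] keep a factor [s]; their zero limit is written out to match the shape
   of [L]. *)
have -> : l = l + \sum_i \sum_j
    0 * (a i j * u 0 (xidx i) * u 0 (xidx j)) * A (xidx i) z * B (xidx j) z.
  by rewrite big1 ?addr0 // => i _; rewrite big1 // => j _; rewrite !mul0r.
apply: cvgD.
  apply: cvg_sumr => i; apply: cvgMl_tmp.
  by apply: cvgB; apply: cvgM; exact: line_cvg.
apply: cvg_sumr => i; apply: cvg_sumr => j.
apply: cvgM; last exact: line_cvg.
apply: cvgM; last exact: line_cvg.
apply: cvgM; last exact: nf_xx_cvg.
exact: nbhs_dnbhs.
Unshelve. all: by end_near. Qed.

(** Theta components that vanish at [z] supply a second factor [s], through their difference
    quotients, so the terms in [{theta, x_i}] and in [{x_i, x_j}] contribute at the same order. *)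
Lemma nf_bracket_cvg2 z u A B : on_axis z ->
  (forall b, {for z, continuous (A b)}) -> (forall b, {for z, continuous (B b)}) ->
  A 0 z = 0 -> B 0 z = 0 -> differentiable (A 0) z -> differentiable (B 0) z ->
  s ^- 2 * (\sum_b \sum_c Pi (cover (z + s *: u)) b c *
            A b (z + s *: u) * B c (z + s *: u)) @[s --> (0 : R)^'] -->
  \sum_i mu i * u 0 (xidx i) *
    ('D_u (A 0) z * B (xidx i) z - A (xidx i) z * 'D_u (B 0) z) +
  \sum_i \sum_j
    (a i j * u 0 (xidx i) * u 0 (xidx j)) * A (xidx i) z * B (xidx j) z.
Proof.
move=> z0 cA cB A0 B0 dA dB; set l := (X in _ --> X).
pose L s := \sum_i mu i * u 0 (xidx i) *
   (s^-1 * (A 0 (z + s *: u) - A 0 z) * B (xidx i) (z + s *: u) -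
    A (xidx i) (z + s *: u) * (s^-1 * (B 0 (z + s *: u) - B 0 z))) +
  \sum_i \sum_j (s ^- 2 * Pi (cover (z + s *: u)) (xidx i) (xidx j)) *
     A (xidx i) (z + s *: u) * B (xidx j) (z + s *: u).
have Us := line_near u (nearU z0).
apply: (@cvg_trans _ (L @ (0 : R)^')).
  apply: near_eq_cvg; near=> s.
  have s0 : s != 0 by near: s; exact: nbhs_dnbhs_neq.
  rewrite /L nf_bracket_sum; last by near: s.
  rewrite A0 B0 !subr0 mulrDr !mulr_sumr; congr (_ + _); apply: eq_bigr => i _.
    by rewrite lineE //; field.
  by rewrite mulr_sumr; apply: eq_bigr => j _; field.
apply: cvgD.
  apply: cvg_sumr => i; apply: cvgMl_tmp.
  apply: cvgB; apply: cvgM; try exact: line_cvg; exact: derive_quotient_cvg.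
apply: cvg_sumr => i; apply: cvg_sumr => j.
apply: cvgM; last exact: line_cvg.
apply: cvgM; last exact: line_cvg.
exact: nf_xx_cvg.
Unshelve. all: by end_near. Qed.

End NormalForm.

(** * Functions of one real variable *)

Section RealFunctions.
Context (R : realType).

(** Two distinct values would, by the intermediate value theorem, put a nondegenerate interval
    inside [A]; but a countable set has Lebesgue measure 0. *)
Lemma continuous_countable_range (f : R -> R) (A : set R) s t :
  continuous f -> countable A -> (forall x, A (f x)) -> f s = f t.
Proof.
move=> cf cA fA; apply: contrapT => /eqP fst.
have {fst} : exists x y, x < y /\ forall v, x <= v <= y -> A v.
  exists (Num.min (f s) (f t)), (Num.max (f s) (f t)); split.
    by case: (ltgtP (f s) (f t)) fst => [||->] //; rewrite eqxx.
  move=> v vst; have cst x y : {within `[x, y], continuous f}.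
    exact: continuous_subspaceT.
  have [st|/ltW ts] := leP s t.
    by have [w _ <-] := IVT st (cst _ _) vst.
  by rewrite minC maxC in vst; have [w _ <-] := IVT ts (cst _ _) vst.
move=> [x [y [xy xyA]]].
have cxy : countable `[x, y].
  apply: sub_countable cA; apply: subset_card_le => v /=.
  by rewrite in_itv /=; exact: xyA.
have := countable_lebesgue_measure0 cxy.
rewrite lebesgue_measure_itv /= lte_fin xy -EFinD => /eqP; rewrite eqe.
by rewrite subr_eq0 gt_eqF.
Qed.

Lemma unit_rotation (C S : R -> R) (c p : R) :
  (forall t : R, is_derive t 1 C (- S t * c)) ->
  (forall t : R, is_derive t 1 S (C t * c)) ->
  (forall t, C t ^+ 2 + S t ^+ 2 = 1) -> C 0 = cos p -> S 0 = sin p ->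
  forall t, C t = cos (c * t + p) /\ S t = sin (c * t + p).
Proof.
move=> dC dS CS C0 S0 t.
(* The inner product of two unit vectors rotating at the same speed. *)
pose E t := C t * cos (c * t + p) + S t * sin (c * t + p).
have dl (s : R) : is_derive s 1 (fun t => c * t + p) c.
  by apply: is_derive_eq; rewrite /GRing.scale /= mulr1 addr0.
have dE (s : R) : is_derive s 1 E 0.
  have dcos := is_derive1_comp (is_derive_cos _) (dl s).
  have dsin := is_derive1_comp (is_derive_sin _) (dl s).
  have H := is_deriveD (is_deriveM (dC s) dcos) (is_deriveM (dS s) dsin).
  by apply: (is_derive_eq H); rewrite /GRing.scale /=; ring.
have E1 : E t = 1.
  by rewrite (is_derive_0_is_cst t 0 dE) /E mulr0 add0r C0 S0 -!expr2 cos2Dsin2.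
(* The squared distance between the two unit vectors is [2 - 2 * E t]. *)
have : (C t - cos (c * t + p)) ^+ 2 + (S t - sin (c * t + p)) ^+ 2 = 0.
  have := CS t; have := cos2Dsin2 (c * t + p); move: E1; rewrite /E.
  nra.
move/eqP; rewrite paddr_eq0 ?sqr_ge0 // !sqrf_eq0 !subr_eq0 => /andP[/eqP -> /eqP ->].
by split.
Qed.

(** Divided by [b1 t * b2 t], the last hypothesis says that [c] is the derivative of a combination
    of logarithms taking the same value at 0 and [T]; Rolle's theorem makes this derivative vanish
    somewhere. *)
Lemma periodic_log_derivative (b1 b2 d1 d2 : R -> R) (T m1 m2 c : R) : 0 < T ->
  (forall t : R, is_derive t 1 b1 (d1 t)) -> (forall t : R, is_derive t 1 b2 (d2 t)) ->
  (forall t, b1 t != 0) -> (forall t, b2 t != 0) -> b1 T = b1 0 -> b2 T = b2 0 ->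
  (forall t, m2 * d1 t * b2 t - m1 * b1 t * d2 t = c * b1 t * b2 t) -> c = 0.
Proof.
move=> T0 db1 db2 b10 b20 b1T b2T E.
(* Squares replace absolute values inside the logarithms, whence the factor 2 in the derivative
   [2 * c]. *)
pose F t := m2 * ln (b1 t ^+ 2) - m1 * ln (b2 t ^+ 2).
have dln (b : R -> R) d (t : R) : b t != 0 -> is_derive t 1 b d ->
    is_derive t 1 (fun t => ln (b t ^+ 2)) (2 * (d / b t)).
  move=> bt0 db.
  have bt2 : 0 < b t ^+ 2 by rewrite exprn_even_gt0.
  have dsq : is_derive t 1 (fun t => b t ^+ 2) (2 * b t * d).
    have H := is_deriveM db db.
    by apply: (is_derive_eq H); rewrite /GRing.scale /=; ring.
  have H := is_derive1_comp (g := fun t => b t ^+ 2) (is_derive1_ln bt2) dsq.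
  by apply: (is_derive_eq H); rewrite /GRing.scale /=; field.
have dF (t : R) : is_derive t 1 F (2 * c).
  have H := is_deriveB (is_deriveZ m2 (dln _ _ _ (b10 t) (db1 t)))
    (is_deriveZ m1 (dln _ _ _ (b20 t) (db2 t))).
  apply: (is_derive_eq H); rewrite /GRing.scale /=.
  apply: (@mulIf _ (b1 t * b2 t)); first by rewrite mulf_neq0.
  transitivity (2 * (m2 * d1 t * b2 t - m1 * b1 t * d2 t)); last by rewrite E; ring.
  by field; rewrite b10 b20.
have [|||t _ dFt] := @Rolle R F 0 T T0.
- by move=> t _; case: (dF t).
- apply: continuous_subspaceT => t; apply: differentiable_continuous.
  by apply/derivable1_diffP; case: (dF t).
- by rewrite /F b1T b2T.
have := derive_val (is_derive := dFt); rewrite (derive_val (is_derive := dF t)).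
by move/eqP; rewrite mulf_eq0 pnatr_eq0 /= => /eqP.
Qed.

End RealFunctions.

(** * Nonzero and distinct exponents from non-resonance *)

Section Nonresonance.
Context (R : realType) (n : nat) (mu : 'I_n -> R).
Context (nr : nonresonant mu).

Let sum2 (i : 'I_n) : (\sum_k (2 * (k == i)))%N = 2.
Proof.
by rewrite (bigD1 i) //= eqxx big1 ?addn0 // => k /negPf ->.
Qed.

Let sum2R (i : 'I_n) : \sum_k (2 * (k == i))%:R * mu k = 2 * mu i.
Proof.
rewrite (bigD1 i) //= eqxx big1 ?addr0 // => k /negPf ->.
by rewrite muln0 mul0r.
Qed.

(** If [mu i] were 0, then [mu i = 2 * mu i] would be a forbidden relation. *)
Lemma nonresonant_neq0 i : mu i != 0.
Proof.
apply/eqP => mui0; have [+ _] := nr.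
by move=> /(_ i (fun k => 2 * (k == i))%N); rewrite sum2 sum2R mui0 mulr0; exact.
Qed.

(** If [mu i = mu j] with [i] and [j] distinct, then [mu i + mu j = 2 * mu i] would be a nontrivial
    relation. *)
Lemma nonresonant_inj : injective mu.
Proof.
move=> i j muij; apply: contrapT => /eqP ij; have [_ +] := nr.
move=> /(_ i j (fun k => 2 * (k == i))%N ij); rewrite sum2 sum2R -muij
  mulr2n mulrDl mul1r.
by move=> /(_ isT erefl i); rewrite eqxx (negPf ij).
Qed.

End Nonresonance.

(** * Components of a smooth map of the cylinder *)

Section SmoothMap.
Context (R : realType) (n : nat) (V : set (cyl R n)) (Phi : cyl R n -> cyl R n).
Context (oV : open V) (sPhi : smooth_map V Phi).
Implicit Types (z w u : 'rV[R]_n.+1).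

Definition xmap (k : 'I_n) z : R := xcoord k (Phi (cover z)).
Definition cosmap z : R := cosq (Phi (cover z)).1.
Definition sinmap z : R := sinq (Phi (cover z)).1.

(* The derivative of the angle of [Phi], which itself is only defined modulo 2 pi. *)
Definition dangle u z : R := cosmap z * 'D_u sinmap z - sinmap z * 'D_u cosmap z.

Let W0 := @cover R n @^-1` V.

Lemma local_lift z : V (cover z) ->
  exists (W : set 'rV[R]_n.+1) (F : 'rV[R]_n.+1 -> 'rV[R]_n.+1),
    [/\ open W, W z, W `<=` W0, forall w, W w -> cover (F w) = Phi (cover w)
      & forall b, smooth W (fun w => F w 0 b)].
Proof.
move=> Vz; have [W [F [oW Wz FE sF]]] := sPhi Vz.
exists (W `&` W0), F; split.
- by apply: openI => //; exact: open_cover.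
- by split.
- by move=> w [].
- by move=> w [+ _]; exact: FE.
- by move=> b k; apply: (Ck_sub _ (sF b k)) => w [].
Qed.

Lemma xmap_smooth k : smooth W0 (xmap k).
Proof.
apply: smooth_local => z /local_lift[W [F [oW Wz WW0 FE sF]]].
exists W, (fun w => F w 0 (xidx k)); split => // w Ww.
by rewrite /xmap -FE // xcoord_cover.
Qed.

Lemma local_angle z : V (cover z) ->
  exists (W : set 'rV[R]_n.+1) (phi : 'rV[R]_n.+1 -> R),
  [/\ open W, W z, W `<=` W0, smooth W phi &
      forall w, W w -> cosmap w = cos (phi w) /\ sinmap w = sin (phi w)].
Proof.
move=> /local_lift[W [F [oW Wz WW0 FE sF]]].
exists W, (fun w => F w 0 0); split => // w Ww.
by rewrite /cosmap /sinmap -FE //= cosq_angle sinq_angle.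
Qed.

Lemma cosmap2Dsinmap2 z : cosmap z ^+ 2 + sinmap z ^+ 2 = 1.
Proof. exact: cos2Dsin2. Qed.

(** A local lift provides a genuine angle function [phi], and the identity
    [cosmap ^+ 2 + sinmap ^+ 2 = 1] reduces [dangle] to its derivative. Facts about [dangle] are
    transferred from [phi]. *)
Lemma local_dangle z : V (cover z) ->
  exists (W : set 'rV[R]_n.+1) (phi : 'rV[R]_n.+1 -> R),
  [/\ open W, W z, W `<=` W0, smooth W phi &
      forall w, W w -> [/\ differentiable cosmap w, differentiable sinmap w &
        forall u, [/\ 'D_u cosmap w = - sinmap w * 'D_u phi w,
         'D_u sinmap w = cosmap w * 'D_u phi w & dangle u w = 'D_u phi w]]].
Proof.
move=> /local_angle[W [phi [oW Wz WW0 sphi CS]]].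
exists W, phi; split => // w Ww.
have dphi := smooth_differentiable sphi Ww.
have nW : nbhs w W by exact: open_nbhs_nbhs.
have nC : \near w, (cos \o phi) w = cosmap w by apply: filterS nW => v /CS[].
have nS : \near w, (sin \o phi) w = sinmap w by apply: filterS nW => v /CS[].
have DC u : 'D_u cosmap w = - sinmap w * 'D_u phi w.
  rewrite -(near_eq_derive _ nC) derive_comp1 //.
  by rewrite derive1E derive_val (CS w Ww).2.
have DS u : 'D_u sinmap w = cosmap w * 'D_u phi w.
  rewrite -(near_eq_derive _ nS) derive_comp1 //.
  by rewrite derive1E derive_val (CS w Ww).1.
split=> [||u].
- by apply: near_eq_differentiable nC _; exact: differentiable_comp1.
- by apply: near_eq_differentiable nS _; exact: differentiable_comp1.
split=> //; rewrite /dangle DC DS -[RHS]mul1r -(cosmap2Dsinmap2 w); ring.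
Qed.

Lemma cosmap_differentiable z : V (cover z) -> differentiable cosmap z.
Proof. by case/local_dangle => W [phi [_ Wz _ _ /(_ _ Wz)[]]]. Qed.

Lemma sinmap_differentiable z : V (cover z) -> differentiable sinmap z.
Proof. by case/local_dangle => W [phi [_ Wz _ _ /(_ _ Wz)[]]]. Qed.

Lemma derive_cosmap z u : V (cover z) -> 'D_u cosmap z = - sinmap z * dangle u z.
Proof. by case/local_dangle => W [phi [_ Wz _ _ /(_ _ Wz)[_ _ /(_ u)[? _ ->]]]]. Qed.

Lemma derive_sinmap z u : V (cover z) -> 'D_u sinmap z = cosmap z * dangle u z.
Proof. by case/local_dangle => W [phi [_ Wz _ _ /(_ _ Wz)[_ _ /(_ u)[_ ? ->]]]]. Qed.

Lemma dangle_continuous z u : V (cover z) -> {for z, continuous (dangle u)}.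
Proof.
case/local_dangle => W [phi [oW Wz _ sphi H]].
apply: (@smooth_continuous _ _ W) => //.
move=> k; apply: (Ck_local (k := k)) => w Ww; exists W, ('D_u phi); split => //.
  by move=> v /H[_ _ /(_ u)[]].
exact: smooth_derive.
Qed.

End SmoothMap.

(** * Differentiation along the axis *)

Section Axis.
Context (R : realType) (n : nat).
Implicit Types (z w u : 'rV[R]_n.+1) (f : 'rV[R]_n.+1 -> R).

Lemma derive0_axis f z : (forall w, on_axis w -> f w = 0) -> on_axis z ->
  'D_(delta_mx 0 0) f z = 0.
Proof.
move=> f0 z0; rewrite -(derive_cst (0 : R) z (delta_mx 0 0)) /derive.
set F := (X in lim (X @ _)); set F' := (X in _ = lim (X @ _)).
suff -> : F = F' by [].
apply/funext => h; rewrite /F /F' /= !f0 // => i.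
by rewrite !mxE z0 mulr0 addr0.
Qed.

End Axis.

(** * Relations imposed by a Poisson isomorphism along [Gamma] *)

Section Equivalence.
Context (R : realType) (n : nat) (U U' V V' : set (cyl R n))
  (Pi Pi' : cyl R n -> 'M[R]_n.+1) (mu mu' : 'I_n -> R) (a a' : 'I_n -> 'I_n -> R)
  (Phi : cyl R n -> cyl R n).
Context (nf : normal_form U Pi mu a) (nf' : normal_form U' Pi' mu' a')
  (VU' : V' `<=` U') (nbV : open_nbhd_Gamma V) (nbV' : open_nbhd_Gamma V')
  (iso : poisson_iso V V' Pi Pi' Phi) (imPhi : Phi @` @Gamma R n = @Gamma R n).
Implicit Types (z w u : 'rV[R]_n.+1).

Local Notation G := (xmap Phi).
Local Notation C := (cosmap Phi).
Local Notation S := (sinmap Phi).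
Local Notation om := (dangle Phi).
Local Notation e_ b := (delta_mx 0 b : 'rV[R]_n.+1).
Local Notation u_ i := (delta_mx 0 (xidx i) : 'rV[R]_n.+1).
Local Notation W0 := (@cover R n @^-1` V).

Let oV : open V. Proof. by case: nbV. Qed.
Let oV' : open V'. Proof. by case: nbV'. Qed.
Let sPhi : smooth_map V Phi. Proof. by case: iso => -[]. Qed.

Let V_axis z : on_axis z -> V (cover z).
Proof. by move=> /Gamma_cover; case: nbV => _; apply. Qed.

Let V'_axis z : on_axis z -> V' (cover z).
Proof. by move=> /Gamma_cover; case: nbV' => _; apply. Qed.

Let nearV z : on_axis z -> \forall w \near z, V (cover w).
Proof.
by move=> z0; apply: open_nbhs_nbhs; split; [exact: open_cover | exact: V_axis].
Qed.

Let PhiV q : V q -> V' (Phi q).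
Proof. by case: iso => -[_ [Psi [_ H _]]] _ /H[]. Qed.

Lemma Phi_Gamma q : Gamma q -> Gamma (Phi q).
Proof. by move=> q0; rewrite -imPhi; exists q. Qed.

Lemma xmap_axis k z : on_axis z -> G k z = 0.
Proof. by move=> /Gamma_cover /Phi_Gamma; rewrite /xmap /xcoord => ->; rewrite mxE. Qed.

Let sG k : smooth W0 (G k). Proof. exact: xmap_smooth. Qed.

Let sDG k b : smooth W0 ('D_(e_ b) (G k)). Proof. exact: smooth_derive. Qed.

Let dG k z : on_axis z -> differentiable (G k) z.
Proof. by move=> z0; apply: smooth_differentiable (sG k) _; exact: V_axis. Qed.

Let dDG k b z : on_axis z -> differentiable ('D_(e_ b) (G k)) z.
Proof. by move=> z0; apply: smooth_differentiable (sDG k b) _; exact: V_axis. Qed.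

Let cDG k z b : on_axis z -> {for z, continuous ('D_(e_ b) (G k))}.
Proof. by move=> z0; apply: smooth_continuous (sDG k b) _; exact: V_axis. Qed.

Lemma derive0_xmap k z : on_axis z -> 'D_(e_ 0) (G k) z = 0.
Proof. by move=> z0; apply: derive0_axis => // w; exact: xmap_axis. Qed.

(** The isomorphism is tested on [xcoord k] and [xcoord l], whose partial derivatives are Kronecker
    deltas, so a single entry of [Pi'] remains. *)
Lemma bracket_xmap k l z : V (cover z) ->
  \sum_b \sum_c Pi (cover z) b c * 'D_(e_ b) (G k) z * 'D_(e_ c) (G l) z =
  Pi' (Phi (cover z)) (xidx k) (xidx l).
Proof.
move=> Vz; have [_ H] := iso.
have := H _ _ (xcoord_smooth V' k) (xcoord_smooth V' l) _ Vz.
rewrite /bracket => E; transitivity (\sum_(b < n.+1) \sum_(c < n.+1)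
  Pi (cover z) b c * partial b (xcoord k \o Phi) (cover z)
                   * partial c (xcoord l \o Phi) (cover z)).
  by apply: eq_bigr => b _; apply: eq_bigr => c _; rewrite !partial_cover.
rewrite E -(lift_ptK (Phi (cover z))); set w := lift_pt _.
rewrite (bigD1 (xidx k)) //= [X in _ + X]big1 => [|b bk]; last first.
  by rewrite big1 // => c _; rewrite partial_xcoord (negPf bk) mulr0 mul0r.
rewrite addr0 (bigD1 (xidx l)) //= [X in _ + X]big1 => [|c cl]; last first.
  by rewrite !partial_xcoord (negPf cl) mulr0.
by rewrite addr0 !partial_xcoord !eqxx !mulr1.
Qed.

Lemma bracket_trig al be k z : V (cover z) ->
  \sum_b \sum_c Pi (cover z) b c * 'D_(e_ b) (fun z => al * C z + be * S z) z
                                 * 'D_(e_ c) (G k) z =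
  (be * C z - al * S z) * mu' k * G k z.
Proof.
move=> Vz; have [_ H] := iso.
have := H _ _ (trigf_smooth V' al be) (xcoord_smooth V' k) _ Vz.
rewrite /bracket => E; transitivity (\sum_(b < n.+1) \sum_(c < n.+1)
  Pi (cover z) b c * partial b (trigf al be \o Phi) (cover z)
                   * partial c (xcoord k \o Phi) (cover z)).
  by apply: eq_bigr => b _; apply: eq_bigr => c _; rewrite !partial_cover.
rewrite E -(lift_ptK (Phi (cover z))); set w := lift_pt _.
rewrite (bigD1 0) //= [X in _ + X]big1 => [|b bk]; last first.
  by rewrite big1 // => c _; rewrite partial_trigf (negPf bk) mul0r mulr0 mul0r.
rewrite addr0 (bigD1 (xidx k)) //= [X in _ + X]big1 => [|c cl]; last first.
  by rewrite !partial_xcoord (negPf cl) mulr0.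
rewrite addr0 partial_trigf partial_xcoord !eqxx mulr1 mul1r.
rewrite lift_ptK (nf_theta_x nf'); last exact/VU'/PhiV.
rewrite /trigf -/(xcoord k _) -/(G k z) -/(C z) -/(S z); ring.
Qed.

(* The angle is not a function on the cylinder: the relation is recovered as
   cos * {sin, x_k} - sin * {cos, x_k}. *)
Lemma bracket_dangle k z : V (cover z) ->
  \sum_b \sum_c Pi (cover z) b c * om (e_ b) z * 'D_(e_ c) (G k) z = mu' k * G k z.
Proof.
move=> Vz.
have D al be b : 'D_(e_ b) (fun z => al * C z + be * S z) z =
    al * 'D_(e_ b) C z + be * 'D_(e_ b) S z.
  have dC := diff_derivable (v := e_ b) (cosmap_differentiable oV sPhi Vz).
  have dS := diff_derivable (v := e_ b) (sinmap_differentiable oV sPhi Vz).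
  by rewrite deriveD; [rewrite !deriveZ|exact: derivableZ..].
have ES := bracket_trig 0 1 k Vz; have EC := bracket_trig 1 0 k Vz.
transitivity (C z * ((1 * C z - 0 * S z) * mu' k * G k z)
              - S z * ((0 * C z - 1 * S z) * mu' k * G k z)); last first.
  by rewrite -[RHS]mul1r -[X in _ = X * _](cosmap2Dsinmap2 Phi z); ring.
rewrite -ES -EC !mulr_sumr -sumrB; apply: eq_bigr => b _.
rewrite !mulr_sumr -sumrB; apply: eq_bigr => c _; rewrite !D /dangle; ring.
Qed.

Let u_x i j : u_ i 0 (xidx j) = (i == j)%:R.
Proof. by rewrite mxE /= (inj_eq lift_inj) eq_sym. Qed.

(** This is the first order part of [bracket_dangle] in the direction of [x_i]. The other product in
    the bracket drops out because [G k] vanishes all along the axis. *)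
Lemma linear_relation z i k : on_axis z ->
  mu i * om (e_ 0) z * 'D_(u_ i) (G k) z = mu' k * 'D_(u_ i) (G k) z.
Proof.
move=> z0.
have H := nf_bracket_cvg1 nf (u := u_ i) (A := fun b => om (e_ b)) z0
   (fun b => @dangle_continuous _ _ _ _ oV sPhi z (e_ b) (V_axis z0))
   (fun b => @cDG k z b z0).
have -> : mu i * om (e_ 0) z * 'D_(u_ i) (G k) z = \sum_j mu j * u_ i 0 (xidx j) *
      (om (e_ 0) z * 'D_(e_ (xidx j)) (G k) z -
       om (e_ (xidx j)) z * 'D_(e_ 0) (G k) z).
  rewrite (bigD1 i) //= big1 => [|j ji]; last first.
    by rewrite u_x eq_sym (negPf ji) mulr0 mul0r.
  by rewrite u_x eqxx derive0_xmap // mulr1 mulr0 subr0 addr0 mulrA.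
(* The quotient in [H] has a second limit: its numerator is [mu' k * G k], which vanishes at [z]. *)
apply: (cvg_unique _ H) => //.
have Vs := line_near (u_ i) (nearV z0).
apply: (@cvg_trans _
  ((fun s : R => mu' k * (s^-1 * (G k (z + s *: u_ i) - G k z))) @ (0 : R)^')).
  apply: near_eq_cvg; near=> s.
  rewrite /= bracket_dangle; last by near: s.
  by rewrite (xmap_axis k z0) subr0 mulrCA.
by apply: cvgMl_tmp; exact/derive_quotient_cvg/dG.
Unshelve. all: by end_near. Qed.

Lemma lift_on_axis z (F : 'rV[R]_n.+1 -> 'rV[R]_n.+1) :
  on_axis z -> cover (F z) = Phi (cover z) -> on_axis (F z).
Proof. by move=> /Gamma_cover /Phi_Gamma; rewrite -Gamma_cover => + ->. Qed.

(** The transverse coordinates of a local lift [F] of [Phi] are the [G i], so this is [nf_xx_bound]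
    at [F z] pulled back by the continuous map [F]. *)
Lemma target_bound z k l e : on_axis z -> 0 < e -> \forall w \near z,
  `|Pi' (Phi (cover w)) (xidx k) (xidx l) - a' k l * G k w * G l w|
    <= e * (\sum_i `|G i w|) ^+ 2.
Proof.
move=> z0 e0; have [W [F [oW Wz _ FE sF]]] := local_lift oV sPhi (V_axis z0).
have cF : {for z, continuous F}.
  by apply: continuous_row => b; exact: smooth_continuous (sF b) Wz.
have /cF := nf_xx_bound nf' k l (lift_on_axis z0 (FE _ Wz)) e0.
have : \forall w \near z, W w by exact: open_nbhs_nbhs.
apply: filterS2 => w Ww /=.
have GE i : F w 0 (xidx i) = G i w by rewrite /xmap -FE // xcoord_cover.
have -> : \sum_i `|G i w| = xnorm (F w) by apply: eq_bigr => i _; rewrite -GE.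
by rewrite FE // -!GE.
Qed.

Lemma target_cvg z u k l : on_axis z ->
  s ^- 2 * Pi' (Phi (cover (z + s *: u))) (xidx k) (xidx l) @[s --> (0 : R)^'] -->
  a' k l * 'D_u (G k) z * 'D_u (G l) z.
Proof.
move=> z0.
have cG i : s^-1 * G i (z + s *: u) @[s --> (0 : R)^'] --> 'D_u (G i) z.
  have := derive_quotient_cvg (u := u) (dG i z0).
  by under eq_cvg do rewrite (xmap_axis i z0) subr0.
pose Q s := a' k l * (s^-1 * G k (z + s *: u)) * (s^-1 * G l (z + s *: u)).
have cQ : Q s @[s --> (0 : R)^'] --> a' k l * 'D_u (G k) z * 'D_u (G l) z.
  by apply: cvgM; [apply: cvgMl_tmp|]; exact: cG.
pose P s := s ^- 2 * Pi' (Phi (cover (z + s *: u))) (xidx k) (xidx l).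
(* By [target_bound] this difference is at most a small constant times the square of the sum of the
   [s^-1 * G i], in absolute value, and that square converges to [M]. *)
suff cPQ : P s - Q s @[s --> (0 : R)^'] --> 0.
  have := cvgD cPQ cQ; rewrite add0r => cPQQ.
  apply: (@cvg_trans _ ((fun s => P s - Q s + Q s) @ (0 : R)^')); last exact: cPQQ.
  by apply: near_eq_cvg; apply: nearW => s; rewrite subrK.
pose M := (\sum_i `|'D_u (G i) z|) ^+ 2.
have cM : (\sum_i `|s^-1 * G i (z + s *: u)|) ^+ 2 @[s --> (0 : R)^'] --> M.
  have cS : \sum_i `|s^-1 * G i (z + s *: u)| @[s --> (0 : R)^'] -->
      \sum_i `|'D_u (G i) z|.
    by apply: cvg_sumr => i; apply: cvg_norm; exact: cG.
  by rewrite /M expr2; under eq_cvg do rewrite expr2; exact: cvgM.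
have M0 : 0 <= M by exact: sqr_ge0.
apply/cvgr0Pnorm_le => e e0.
(* [M + 1] is eventually an upper bound for a quantity tending to [M], and it is positive. *)
pose e' := e / (M + 1); have e'0 : 0 < e' by rewrite divr_gt0 // ltr_wpDl.
have Hb := line_near u (target_bound k l z0 e'0).
near=> s.
have s0 : s != 0 by near: s; exact: nbhs_dnbhs_neq.
have : `|Pi' (Phi (cover (z + s *: u))) (xidx k) (xidx l) -
     a' k l * G k (z + s *: u) * G l (z + s *: u)| <=
     e' * (\sum_i `|G i (z + s *: u)|) ^+ 2 by near: s.
have -> : P s - Q s = s ^- 2 * (Pi' (Phi (cover (z + s *: u))) (xidx k) (xidx l) -
     a' k l * G k (z + s *: u) * G l (z + s *: u)) by rewrite /P /Q; field.
have s20 : 0 < s ^+ 2 by rewrite exprn_even_gt0.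
move=> H; rewrite normrM ger0_norm ?invr_ge0 ?sqr_ge0 // ler_pdivrMl //.
apply: (le_trans H).
have -> : \sum_i `|G i (z + s *: u)| = `|s| * \sum_i `|s^-1 * G i (z + s *: u)|.
  rewrite mulr_sumr; apply: eq_bigr => i _.
  by rewrite -normrM mulrA divff // mul1r.
rewrite exprMn -normrX (ger0_norm (sqr_ge0 s)) mulrCA ler_wpM2l ?sqr_ge0 //.
rewrite /e' -mulrA ler_piMr ?(ltW e0) // ler_pdivrMl ?ltr_wpDl // mulr1.
near: s; apply: (cvgr_le _ cM).
by rewrite ltrDl.
Unshelve. all: by end_near. Qed.

(** Both sides are the second order limit of the same bracket, computed in the source by
    [nf_bracket_cvg2] and in the target by [target_cvg]. The theta components of the differentials
    vanish on the axis, as [nf_bracket_cvg2] requires. *)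
Lemma quadratic_relation z u k l : on_axis z ->
  \sum_i mu i * u 0 (xidx i) *
    ('D_u ('D_(e_ 0) (G k)) z * 'D_(u_ i) (G l) z -
     'D_(u_ i) (G k) z * 'D_u ('D_(e_ 0) (G l)) z) +
  \sum_i \sum_j (a i j * u 0 (xidx i) * u 0 (xidx j)) *
    'D_(u_ i) (G k) z * 'D_(u_ j) (G l) z =
  a' k l * 'D_u (G k) z * 'D_u (G l) z.
Proof.
move=> z0; have T := @target_cvg z u k l z0.
have H := nf_bracket_cvg2 nf (u := u) (A := fun b => 'D_(e_ b) (G k))
  (B := fun b => 'D_(e_ b) (G l)) z0 (fun b => @cDG k z b z0) (fun b => @cDG l z b z0)
  (derive0_xmap k z0) (derive0_xmap l z0) (@dDG k 0 z z0) (@dDG l 0 z z0).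
have Vs := line_near u (nearV z0).
apply/esym; apply: (cvg_unique _ T) => //.
apply: (cvg_trans _ H); apply: near_eq_cvg.
by near=> s; rewrite -bracket_xmap //; near: s.
Unshelve. all: by end_near. Qed.

(** The chain rule for the inverse [Psi] after [Phi] gives 1 for the derivative of [x_i] along
    itself. The theta term is 0 because [Psi] preserves [Gamma], so not all the transverse terms can
    vanish. *)
Lemma xmap_derive_neq0 z i : on_axis z -> exists k, 'D_(u_ i) (G k) z != 0.
Proof.
move=> z0; have [[_ [Psi [sPsi PsiPhi _]]] _] := iso.
have [W [F [oW Wz WV FE sF]]] := local_lift oV sPhi (V_axis z0).
pose h := xmap Psi i.
have Fz := lift_on_axis z0 (FE _ Wz).
have sh : smooth (@cover R n @^-1` V') h by exact: xmap_smooth.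
have h0 w : on_axis w -> h w = 0.
  move=> /Gamma_cover; rewrite -imPhi => -[q q0 Eq].
  have Vq : V q by case: nbV => _; apply.
  by rewrite /h /xmap -Eq (PsiPhi q Vq).2 /xcoord q0 mxE.
have hF : \near z, (h \o F) z = z 0 (xidx i).
  apply: filterS (open_nbhs_nbhs (conj oW Wz)) => w Ww.
  by rewrite /h /xmap /= FE // (PsiPhi _ (WV w Ww)).2 xcoord_cover.
have := near_eq_derive (u_ i) hF.
rewrite derive_coord u_x eqxx derive_comp_row; first last.
- by apply: (smooth_differentiable sh); exact: V'_axis.
- by move=> b; apply: (smooth_differentiable (sF b)).
rewrite big_ord_recl derive0_axis // mulr0 add0r => E.
apply/existsP; rewrite -negb_forall; apply/negP => /forallP G0.
move: E; rewrite big1 => [/eqP|k _]; first by rewrite eq_sym oner_eq0.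
have -> : 'D_(u_ i) (fun w => F w 0 (lift ord0 k)) z = 'D_(u_ i) (G k) z.
  apply: near_eq_derive; apply: filterS (open_nbhs_nbhs (conj oW Wz)) => w Ww.
  by rewrite /xmap -FE // xcoord_cover.
by rewrite (eqP (G0 k)) mul0r.
Qed.

(** Exchanging the derivatives with [schwarz] identifies the mixed derivative of
    [quadratic_relation] with the derivative in [t] of a coefficient along the axis. *)
Lemma is_derive_axis_xmap u k (t : R) :
  is_derive t 1 (fun t => 'D_u (G k) (axis n t)) ('D_u ('D_(e_ 0) (G k)) (axis n t)).
Proof.
have z0 : on_axis (axis n t) by exact: axisx.
have -> : 'D_u ('D_(e_ 0) (G k)) (axis n t) = 'D_(e_ 0) ('D_u (G k)) (axis n t).
  by apply: (schwarz _ _ (open_cover oV) _ (sG k)); exact: V_axis.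
have dDu : derivable ('D_u (G k)) (0 + t *: e_ 0) (e_ 0).
  rewrite -axisE; apply: diff_derivable; apply: smooth_differentiable (V_axis z0).
  exact: smooth_derive.
by have := is_derive_line dDu; under eq_fun do rewrite add0r; rewrite -axisE.
Qed.

(** By [linear_relation] and [xmap_derive_neq0] every value is some [mu' k / mu i0], and a
    continuous function with countable range is constant. The index [i0] supplies a transverse
    direction, without which [Phi] could be any diffeomorphism of the circle. *)
Lemma angle_speed_constant (i0 : 'I_n) : exists2 c : R,
  c != 0 & forall t : R, dangle Phi (e_ 0) (axis n t) = c.
Proof.
pose f t := dangle Phi (e_ 0) (axis n t).
have fmu t : exists k, f t * mu i0 = mu' k.
  have [k Bk] := xmap_derive_neq0 i0 (axisx t); exists k.
  by apply: (mulIf Bk); rewrite -linear_relation ?[f t * _]mulrC //; exact: axisx.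
exists (f 0).
  have [k fk] := fmu 0; apply/eqP => f0; have := nonresonant_neq0 (nf_nonresonant nf') k.
  by rewrite -fk f0 mul0r eqxx.
move=> t; apply: (@continuous_countable_range R f [set mu' k / mu i0 | k in setT]).
- move=> s; apply: (@continuous_comp _ _ _ (axis n) (dangle Phi (e_ 0))).
    exact: scalel_continuous.
  by apply: (@dangle_continuous _ _ _ _ oV sPhi _ (e_ 0)); exact/V_axis/axisx.
- by apply: sub_countable (card_image_le _ _) _; exact: countableP.
move=> s; have [k fk] := fmu s; exists k => //; rewrite -fk.
by rewrite mulfK // nonresonant_neq0 //; exact: nf_nonresonant nf.
Qed.

Lemma Phi_on_Gamma (c : R) : (forall t : R, dangle Phi (e_ 0) (axis n t) = c) ->
  exists p : R, forall t, Phi (angle t, 0) = (angle (c * t + p), 0).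
Proof.
move=> fc.
have Vt t : V (cover (axis n t)) by exact/V_axis/axisx.
have dC (t : R) :
    is_derive t 1 (fun t => cosmap Phi (axis n t)) (- sinmap Phi (axis n t) * c).
  rewrite -[c](fc t) -(derive_cosmap oV sPhi) // axisE.
  rewrite (_ : (fun t => _) = (fun t => cosmap Phi (0 + t *: e_ 0))).
    apply: is_derive_line; apply: diff_derivable; rewrite -axisE.
    exact: cosmap_differentiable (Vt t).
  by apply/funext => s; rewrite axisE.
have dS (t : R) :
    is_derive t 1 (fun t => sinmap Phi (axis n t)) (cosmap Phi (axis n t) * c).
  rewrite -[c](fc t) -(derive_sinmap oV sPhi) // axisE.
  rewrite (_ : (fun t => _) = (fun t => sinmap Phi (0 + t *: e_ 0))).
    apply: is_derive_line; apply: diff_derivable; rewrite -axisE.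
    exact: sinmap_differentiable (Vt t).
  by apply/funext => s; rewrite axisE.
(* With this representative as phase, both initial conditions of [unit_rotation] hold by definition
   of [cosq] and [sinq]. *)
exists (repr (Phi (cover (axis n 0))).1) => t.
have := unit_rotation dC dS (fun t => cosmap2Dsinmap2 Phi (axis n t)) erefl erefl t.
move=> [Ct St].
have <- : cover (axis n t) = (angle t, 0) by rewrite cover_axis ?axis0 //; exact: axisx.
rewrite [LHS]surjective_pairing; congr pair; first exact: angle_eq_cossin.
by apply: Phi_Gamma; apply/Gamma_cover/axisx.
Qed.

(** Angles 0 and [2 * pi] have the same image, so [c] is an integer. Angles 0 and [c^-1 * (2 * pi)]
    do too, so by injectivity [c^-1] is an integer. *)
Lemma angle_speed_unit (c p : R) : c != 0 ->
  (forall t, Phi (angle t, 0) = (angle (c * t + p), 0)) -> c = 1 \/ c = -1.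
Proof.
move=> c0 Phic.
have pi2 : 2 * pi != 0 :> R by rewrite mulf_neq0 // gt_eqF // pi_gt0.
have inj s t : Phi (angle s, 0) = Phi (angle t, 0) -> angle s = angle t.
  move=> E; have [[_ [Psi [_ H _]]] _] := iso.
  have VG r : V (angle r, 0) by case: nbV => _; apply.
  have := (H _ (VG s)).2; rewrite E (H _ (VG t)).2.
  by case.
have [k Ek] : exists k : int, c = k%:~R.
  have per : angle (2 * pi) = angle 0 :> circle R.
    by apply/eqP/angleP; exists (- 1); rewrite rmorphN mulN1r subrr.
  have := Phic (2 * pi); rewrite per Phic => -[/eqP/angleP[k Ek]].
  exists k; apply: (mulIf pi2); move: Ek; rewrite mulr0; lra.
have [l El] : exists l : int, c^-1 = l%:~R.
  have /inj/eqP/angleP[l El] : Phi (angle 0, 0) = Phi (angle (c^-1 * (2 * pi)), 0).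
    rewrite !Phic; congr pair; rewrite mulrA divff // mul1r mulr0.
    by apply/eqP/angleP; exists 1; ring.
  by exists l; apply: (mulIf pi2); rewrite El add0r.
have kl : k * l = 1.
  by apply: (@intr_inj R); rewrite intrM -Ek -El divff.
have /eqP := congr1 absz kl; rewrite abszM muln_eq1 => /andP[/eqP k1 _].
by rewrite Ek; case: k k1 {Ek kl} => [[|[|k]]|[|k]] //= _; [left|right].
Qed.

Lemma parameter_permutation (c : R) : c != 0 ->
  (forall t : R, dangle Phi (e_ 0) (axis n t) = c) ->
  exists sigma : {perm 'I_n}, (forall i, mu' (sigma i) = c * mu i) /\
    forall (t : R) i k, ('D_(u_ i) (G k) (axis n t) != 0) = (k == sigma i).
Proof.
move=> c0 fc.
have rel t i k : 'D_(u_ i) (G k) (axis n t) != 0 -> mu' k = c * mu i.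
  move=> Bk; apply: (mulIf Bk); rewrite -linear_relation; last exact: axisx.
  by rewrite fc [c * _]mulrC.
(* The permutation is chosen at parameter 0 but serves for all [t]: the relation [mu' k = c * mu i]
   does not involve [t], and it determines [k] because the [mu'] are distinct. *)
have /choice[s sB] := fun i => xmap_derive_neq0 i (axisx 0).
have smu i : mu' (s i) = c * mu i by exact: rel (sB i).
have sinj : injective s.
  move=> i j sij; apply: (nonresonant_inj (nf_nonresonant nf)).
  by apply: (mulfI c0); rewrite -!smu sij.
exists (perm sinj); split=> [i|t i k]; first by rewrite permE.
have H k' : 'D_(u_ i) (G k') (axis n t) != 0 -> k' = s i.
  by move=> /rel; rewrite -smu => /(nonresonant_inj (nf_nonresonant nf')).
rewrite permE; apply/idP/eqP => [/H //|->].
by have [k' Bk'] := xmap_derive_neq0 i (axisx t); rewrite -(H _ Bk').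
Qed.

Lemma xmap_periodic (u : 'rV[R]_n.+1) k t :
  'D_u (G k) (axis n (t + 2 * pi)) = 'D_u (G k) (axis n t).
Proof.
rewrite /axis scalerDl addrC -derive_translate.
have -> : (fun w => G k ((2 * pi) *: e_ 0 + w)) = G k => //.
apply/funext => w; rewrite /xmap; congr (xcoord k (Phi _)).
rewrite /cover; congr pair; last first.
  by apply/rowP => i; rewrite !mxE mulr0 add0r.
apply/eqP/angleP; exists (- 1); rewrite !mxE !eqxx rmorphN mulN1r mulr1; ring.
Qed.

Lemma quadratic_parameters (sigma : {perm 'I_n}) :
  (forall (t : R) i k, ('D_(u_ i) (G k) (axis n t) != 0) = (k == sigma i)) ->
  forall i j, a' (sigma i) (sigma j) = a i j.
Proof.
move=> B i j.
have [<-|ij] := eqVneq i j.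
  (* On the diagonal both constants are 0 by antisymmetry. *)
  have diag (b : 'I_n -> 'I_n -> R) k : (forall i j, b i j = - b j i) -> b k k = 0.
    by move=> /(_ k k) /esym/eqP; rewrite eqNr => /eqP.
  by rewrite !diag //; [exact: nf_anti nf | exact: nf_anti nf'].
(* The direction [u] isolates the coefficient of [x_i x_j]. *)
pose u := u_ i + u_ j; pose b k t := 'D_u (G k) (axis n t).
have B0 t m k : k != sigma m -> 'D_(u_ m) (G k) (axis n t) = 0.
  by move=> km; apply/eqP; rewrite -[_ == _]negbK B (negPf km).
have bE k t : b k t = 'D_(u_ i) (G k) (axis n t) + 'D_(u_ j) (G k) (axis n t).
  by rewrite /b !deriveE ?linearD //; exact/dG/axisx.
have sij : sigma i != sigma j by rewrite (inj_eq perm_inj).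
have bi t : b (sigma i) t = 'D_(u_ i) (G (sigma i)) (axis n t).
  by rewrite bE [X in _ + X]B0 ?addr0.
have bj t : b (sigma j) t = 'D_(u_ j) (G (sigma j)) (axis n t).
  by rewrite bE B0 ?add0r // eq_sym.
have ux m : u 0 (xidx m) = (m == i)%:R + (m == j)%:R.
  by rewrite !mxE /= !(inj_eq lift_inj).
pose d k t := 'D_u ('D_(e_ 0) (G k)) (axis n t).
(* In [quadratic_relation] the direction [u] keeps only the indices [i] and [j], and [B0] removes
   every product except those of [G (sigma i)] along [x_i] with [G (sigma j)] along [x_j]. *)
have Q t : mu j * d (sigma i) t * b (sigma j) t - mu i * b (sigma i) t * d (sigma j) t
    = (a' (sigma i) (sigma j) - a i j) * b (sigma i) t * b (sigma j) t.
  have := quadratic_relation u (sigma i) (sigma j) (axisx t).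
  rewrite -/(b (sigma i) t) -/(b (sigma j) t) -/(d _ t) -/(d _ t).
  rewrite (bigD1 i) //= (bigD1 j) ?[j == i]eq_sym //= big1 => [|m /andP[mi mj]]; last first.
    by rewrite ux (negPf mi) (negPf mj) addr0 mulr0 mul0r.
  rewrite [X in _ + X = _](bigD1 i) //= [X in _ + (_ + X) = _]big1 => [|m mi]; last first.
    rewrite big1 // => m' _; rewrite [X in _ * X * _]B0 ?mulr0 ?mul0r //.
    by rewrite (inj_eq perm_inj) eq_sym.
  rewrite (bigD1 j) //= [X in _ + (_ + X + _) = _]big1 => [|m mj]; last first.
    by rewrite [X in _ * X]B0 ?mulr0 // (inj_eq perm_inj) eq_sym.
  rewrite !ux !eqxx (negPf ij) [j == i]eq_sym (negPf ij) -bi -bj.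
  rewrite (B0 t i (sigma j)) ?(B0 t j (sigma i)) // 1?eq_sym //.
  move=> E; rewrite mulrBl mulrBl -E /=; ring.
apply/eqP; rewrite -subr_eq0; apply/eqP.
apply: (periodic_log_derivative (T := 2 * pi) _ _ _ _ _ _ _ Q).
- by rewrite mulr_gt0 // pi_gt0.
- by move=> t; exact: is_derive_axis_xmap.
- by move=> t; exact: is_derive_axis_xmap.
- by move=> t; rewrite bi B.
- by move=> t; rewrite bj B.
- by rewrite -[2 * pi]add0r; exact: xmap_periodic.
- by rewrite -[2 * pi]add0r; exact: xmap_periodic.
Qed.

End Equivalence.

(** * Orientation of the circle *)

Section Orientation.
Context (R : realType) (n : nat) (Phi : cyl R n -> cyl R n) (p : R).

Lemma translation_preserves_orientation :
  (forall t, Phi (angle t, 0) = (angle (t + p), 0)) -> preserves_orientation_Gamma Phi.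
Proof.
move=> Phip; exists (fun t => t + p); split => //.
  by move=> t; apply: cvgD; [exact: cvg_id | exact: cvg_cst].
by move=> s t st; rewrite ltrD2r.
Qed.

(** For an increasing lift [f], the continuous function [f t + t] would take its values in a
    translate of the multiples of [2 * pi], hence be constant, although it is strictly
    increasing. *)
Lemma reflection_reverses_orientation :
  (forall t, Phi (angle t, 0) = (angle (- t + p), 0)) ->
  ~ preserves_orientation_Gamma Phi.
Proof.
move=> Phip [f [cf incf fE]].
have := @continuous_countable_range R (fun t => f t + t)
  [set p + k%:~R * (2 * pi) | k in [set: int]] 0 1.
have -> : (f 0 + 0 = f 1 + 1) = False.
  by apply/propext; split => // E; have := incf _ _ (ltr01 : 0 < 1 :> R); lra.
apply.
- by move=> t; apply: cvgD; [exact: cf | exact: cvg_id].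
- by apply: sub_countable (card_image_le _ _) _; exact: countableP.
move=> t; have := fE t; rewrite Phip => -[/eqP/angleP[k Ek]].
by exists k => //; rewrite Ek; ring.
Qed.

End Orientation.

Theorem mainTheorem2 (R : realType) (n : nat)
    (U U' : set (cyl R n)) (Pi Pi' : cyl R n -> 'M[R]_n.+1)
    (mu mu' : 'I_n -> R) (a a' : 'I_n -> 'I_n -> R)
    (Phi : cyl R n -> cyl R n)
    (nfPi : normal_form U Pi mu a) (nfPi' : normal_form U' Pi' mu' a')
    (eqPhi : equivalence_along_Gamma U U' Pi Pi' Phi) :
  exists sigma : {perm 'I_n},
    [/\ forall i j, a' (sigma i) (sigma j) = a i j,
        preserves_orientation_Gamma Phi ->
          forall i, mu' (sigma i) = mu i
      & ~ preserves_orientation_Gamma Phi ->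
          forall i, mu' (sigma i) = - mu i].
Proof.
(* When [n] is 0 there is no index, and every clause is vacuous. *)
have [i0 _|n0] := pickP 'I_n; last first.
  by exists 1%g; split=> [i||]; [|move=> _ i..]; have := n0 i.
have [V [V' [[nbV _] [nbV' VU'] iso imPhi]]] := eqPhi.
have [c c0 fc] := angle_speed_constant nfPi nfPi' VU' nbV nbV' iso imPhi i0.
have [p Phip] := Phi_on_Gamma nbV iso imPhi fc.
have [sigma [smu sB]] := parameter_permutation nfPi nfPi' VU' nbV nbV' iso imPhi c0 fc.
(* The same [sigma] serves all clauses: it is obtained before the sign of [c] is known, and the
   equality of the [a] does not depend on that sign. *)
exists sigma; split; first exact: (quadratic_parameters nfPi nfPi' nbV iso imPhi sB).
  move=> po i; rewrite smu.
  have [->|cN1] := angle_speed_unit nbV iso c0 Phip; first by rewrite mul1r.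
  (* For [c = -1], [Phi] acts on [Gamma] as a reflection, against the assumed orientation. *)
  have [] := @reflection_reverses_orientation _ _ Phi p _ po => t.
  by rewrite Phip cN1 mulN1r.
move=> npo i; rewrite smu.
have [c1|->] := angle_speed_unit nbV iso c0 Phip; last by rewrite mulN1r.
have [] := npo; apply: (@translation_preserves_orientation _ _ Phi p) => t.
by rewrite Phip c1 mul1r.
Qed.
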